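(* Let $(X_N)_N$ be a full Wigner ensemble with arbitrary mean $m$ and variance $v$. Then the second largest singular value $\|X_N\|'_{op}$ of $X_N$ satisfies $$\mathbb{P}\Big(\lim_{N\to\infty}\frac{\|X_N\|'_{op}}{\sqrt N}=2\sqrt v\Big)=1.$$
   Context: A (full) Wigner ensemble with mean $m$ and variance $v$ is a sequence $(X_N)_{N\ge1}$ of random real symmetric $N\times N$ matrices on a common probability space $(\Omega,\mathcal{F},\mathbb{P})$ such that for each fixed $N$ the entries $X_N(i,j)$, $1\le i\le j\le N$, are independent, and all entries $X_N(i,j)$ (for all $N,i,j$) have one common distribution $\rho$ on $\mathbb{R}$ with finite moments of all orders; $m=\int x\,d\rho(x)$ and $v=\int x^2\,d\rho(x)-m^2$. Nothing is assumed about the joint dependence of $X_N$ and $X_M$ for $N\ne M$. The case $v=0$ is allowed. The singular values of a real symmetric $N\times N$ matrix are the absolute values of its eigenvalues, ordered as $0\le s_1\le s_2\le\dots\le s_N$ and repeated according to multiplicity; for $N\ge2$, $\|X_N\|'_{op}:=s_{N-1}(X_N)$. *)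

(* Defs.v *)
From HB Require Import structures.
From mathcomp Require Import all_boot all_order all_algebra.
From mathcomp Require Import all_classical all_reals all_analysis.
From mathcomp Require Import polyrcf.

Set Implicit Arguments.
Unset Strict Implicit.
Unset Printing Implicit Defensive.
Import Order.TTheory GRing.Theory Num.Theory.
Import numFieldNormedType.Exports.
Local Open Scope classical_set_scope.
Local Open Scope ring_scope.

(* The real roots of the characteristic polynomial, each repeated according to
   its multiplicity; [rootsR] lists the distinct real roots.  When [A] is
   symmetric all roots are real, so the sequence has length [n]. *)
Definition eigenvalues (R : rcfType) (n : nat) (A : 'M[R]_n) : seq R :=
  flatten [seq nseq (mup x (char_poly A)) x | x <- rootsR (char_poly A)].

(* Only meant for symmetric [A]: in general a singular value is not the absolute
   value of an eigenvalue. *)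
Definition singular_values (R : rcfType) (n : nat) (A : 'M[R]_n) : seq R :=
  sort <=%R [seq `|x| | x <- eigenvalues A].

(* The entry s_{n-1} of 0 <= s_1 <= ... <= s_n is at 0-based position [n - 2];
   the value is meaningful for [2 <= n] only. *)
Definition second_singular_value (R : rcfType) (n : nat) (A : 'M[R]_n) : R :=
  nth 0 (singular_values A) (n - 2).

Definition independent_RVs d (T : measurableType d) (R : realType)
    (P : probability T R) (I : finType) (D : {set I}) (Y : I -> {RV P >-> R}) :=
  forall (J : {set I}) (B : I -> set R), J \subset D ->
    (forall i, measurable (B i)) ->
    P (\bigcap_(i in [set` J]) (Y i @^-1` B i)) =
      (\prod_(i in J) P (Y i @^-1` B i))%E.

Definition sample d (T : measurableType d) (R : realType) (P : probability T R)
    (n : nat) (A : 'M[{RV P >-> R}]_n) (w : T) : 'M[R]_n :=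
  \matrix_(i, j) A i j w.

(* The common law is compared with [rho] on measurable sets only: the values of
   a measure elsewhere carry no information.  The matrix of size 0, which has no
   entries, is included for uniformity. *)
Record wigner_ensemble d (T : measurableType d) (R : realType)
    (P : probability T R) (m v : R) (X : forall N : nat, 'M[{RV P >-> R}]_N)
    (rho : probability R R) : Prop := WignerEnsemble {
  wigner_symmetric : forall N w, (sample (X N) w)^T = sample (X N) w ;
  wigner_independent : forall N,
    independent_RVs [set ij : 'I_N * 'I_N | (ij.1 <= ij.2)%N]
      (fun ij => X N ij.1 ij.2) ;
  wigner_law : forall N (i j : 'I_N) (B : set R), measurable B ->
    distribution P (X N i j) B = rho B ;
  wigner_moments : forall k : nat,
    rho.-integrable setT (fun x : R => (x ^+ k)%:E) ;
  wigner_mean : (\int[rho]_x x%:E)%E = m%:E ;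
  wigner_variance : (\int[rho]_x (x ^+ 2)%:E - (m ^+ 2)%:E)%E = v%:E }.

(* Main.v *)
Require Import Defs.
From HB Require Import structures.
From mathcomp Require Import all_boot all_order all_algebra.
From mathcomp Require Import all_classical all_reals all_analysis.
From mathcomp Require Import measurable_realfun polyrcf complex ring lra zify.

(** The entries are truncated at a level [L] of order [N ^ (1/q)] and centred by the
    mean of the truncated law.  Almost surely, for all large [N], no entry exceeds
    [L]; the centred truncated matrix [W] then differs from the sample by a constant
    matrix, which has rank one, so the number of singular values above any level
    changes by at most one ([eigenbasis_count_le]).  This is why an arbitrary mean is
    invisible in the second largest singular value, and why it suffices to bound the
    largest singular value of [W] from above and the third largest from below.

    Upper bound.  The expectation of [\tr (W ^+ (2 * L))] is a sum over closed walks
    whose weight is a product of moments, one for each distinct edge.  Instead of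
    classifying walks by shape, a potential is attached to every history of a walk:
    it discounts edges crossed once by [N ^ (-1/2)] and charges for the vertices at
    which going back is ambiguous.  One step multiplies it by at most
    [2 * sigma * sqrt N] plus a polynomial in [L], which is [o(sqrt N)] if [q] is large
    ([sum_potential]).  Hence the expectation is at most
    [N * ((2 * sqrt v + o(1)) * sqrt N) ^ (2 * L)], and as [L] is a power of [N],
    Markov's inequality gives probabilities that decay faster than any power of [N]
    ([trace_upper_rate]).

    Lower bound.  For fixed [k] the walks that only open new edges and close the last
    open one dominate, and ballot paths count them, so the expectation of
    [\tr (W ^+ (2 * k))] divided by [N ^ (k + 1)] tends to [v ^ k] times a Catalan
    number ([mean_trace_cvg]).  The variance of the trace is at most [N ^ (2 * k)] up to a
    power of [L], because two closed walks are correlated only if they share an edge,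
    and then they visit at most [2 * k] vertices together
    ([shared_edge_vertices_le]).  The Catalan numbers grow like [4 ^ k], so if at most
    two singular values were above [t * sqrt N] with [t < 2 * sqrt v], the trace would
    be too small for some [k] ([ballot_exponent], [second_singular_value_lower]).

    All exceptional events have probability [O(N ^ (-3/2))], so Borel and Cantelli's
    lemma yields the almost sure bounds.  The limit is an event because the two largest
    singular values are determined by inequalities between traces of powers
    ([largest_singular_value_le], [singular_value_product_le]). *)

Set Implicit Arguments.
Unset Strict Implicit.
Unset Printing Implicit Defensive.
Import Order.TTheory GRing.Theory Num.Theory.
Import numFieldNormedType.Exports.
Local Open Scope classical_set_scope.
Local Open Scope ring_scope.

(** * Spectra of real symmetric matrices *)

Section SpectralDecomposition.
Variable R : rcfType.
Local Notation C := (complex R).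
Local Notation toC := (real_complex R).

(** The rows of [U] form an orthonormal eigenbasis.  Complex eigenvectors are
    allowed: only norms, traces and dimensions of spans are used. *)
Definition eigenbasis (n : nat) (A : 'M[R]_n) (U : 'M[C]_n) (d : 'I_n -> R) :=
  U *m (map_mx Num.conj U^T) = 1%:M /\
  map_mx toC A = map_mx Num.conj U^T *m diag_mx (\row_i toC (d i)) *m U.

(** A real symmetric matrix is Hermitian, hence normal, and the diagonal of its
    unitary diagonalization is real. *)
Lemma symmetric_eigenbasis n (A : 'M[R]_n) : A^T = A ->
  exists U d, eigenbasis A U d.
Proof.
move=> symA; set B := map_mx toC A.
have hB : B \is hermsymmx.
  apply: realsym_hermsym.
    by apply/is_hermitianmxP; rewrite expr0 scale1r map_mx_id // /B map_trmx symA.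
  apply/mxOverP => i j; rewrite mxE; apply/complex_realP.
  by exists (A i j).
have /orthomx_spectralP eB := hermitian_normalmx hB.
have /mxOverP dR := hermitian_spectral_diag_real hB.
exists (spectralmx B), (fun i => complex.Re (spectral_diag B 0 i)); split.
  by have /unitarymxP := spectral_unitarymx B.
rewrite -/B -invmx_unitary ?spectral_unitarymx // {1}eB.
suff -> : \row_i toC (complex.Re (spectral_diag B 0 i)) = spectral_diag B by [].
by apply/rowP => i; rewrite mxE RRe_real // dR.
Qed.

Lemma eigenbasis_char_poly n (A : 'M[R]_n) U d : eigenbasis A U d ->
  char_poly A = \prod_i ('X - (d i)%:P).
Proof.
case=> UU eA; apply: (@map_poly_inj _ _ toC).
rewrite map_char_poly eA rmorph_prod /=.
set U' := map_mx _ _ in UU *; set D := diag_mx _.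
have U'U : U' *m U = 1%:M by apply: mulmx1C.
have eD : char_poly D = \prod_i ('X - (toC (d i))%:P).
  rewrite char_poly_trig ?diag_mx_is_trig //; apply: eq_bigr => i _.
  by rewrite !mxE eqxx.
transitivity (char_poly D); last first.
  by rewrite eD; apply: eq_bigr => i _; rewrite rmorphB /= map_polyX map_polyC.
rewrite /char_poly.
have -> : char_poly_mx (U' *m D *m U) =
   map_mx polyC U' *m char_poly_mx D *m map_mx polyC U.
  rewrite /char_poly_mx mulmxBr mulmxBl !map_mxM; congr (_ - _).
  by rewrite mul_mx_scalar -scalemxAl -map_mxM U'U map_mx1 scalemx1.
rewrite !det_mulmx mulrAC -det_mulmx -map_mxM U'U map_mx1 det1 mul1r //.
Qed.

Lemma eigenbasis_mxtraceX n (A : 'M[R]_n) U d k : eigenbasis A U d ->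
  \tr (A ^+ k) = \sum_i d i ^+ k.
Proof.
case=> UU eA; apply: (@complexI R).
have U'U := mulmx1C UU.
have eX : map_mx toC (A ^+ k) =
    map_mx Num.conj U^T *m diag_mx (\row_i toC (d i ^+ k)) *m U.
  elim: k => [|k IHk].
    rewrite expr0 map_mx1 (_ : diag_mx _ = 1%:M) ?mulmx1 ?U'U //.
    by apply/matrixP => i j; rewrite !mxE expr0.
  rewrite exprS map_mxM IHk eA !mulmxA -[_ *m U *m _]mulmxA UU mulmx1.
  rewrite -[_ *m diag_mx _ *m diag_mx _]mulmxA mulmx_diag.
  set r1 := \row_j (_ * _); set r2 := \row_i _.
  suff -> : r1 = r2 by [].
  by apply/rowP => i; rewrite !mxE -rmorphM /= exprS.
rewrite -trace_map_mx eX mxtrace_mulC mulmxA UU mul1mx mxtrace_diag rmorph_sum.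
by apply: eq_bigr => i _; rewrite mxE.
Qed.

(** The sorted distinct roots with multiplicities list the same numbers as the
    diagonal of any diagonalization. *)
Lemma eigenvalues_perm n (A : 'M[R]_n) (d : 'I_n -> R) :
  char_poly A = \prod_i ('X - (d i)%:P) ->
  perm_eq (eigenvalues A) [seq d i | i <- enum 'I_n].
Proof.
move=> eA; apply/allP => x _ /=; apply/eqP.
have A0 : char_poly A != 0 by rewrite monic_neq0 ?char_poly_monic.
have eA' : char_poly A = \prod_(y <- [seq d i | i <- enum 'I_n]) ('X - y%:P).
  by rewrite big_map eA -big_enum.
rewrite -[RHS]mu_prod_XsubC -eA' /eigenvalues.
set p := char_poly A.
have us : uniq (rootsR p) by apply: uniq_roots.
have ms : (x \in rootsR p) = root p x.
  by have := roots_on_rootsR A0 x; rewrite in_itv.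
case: (boolP (root p x)) => [|rx]; last first.
  rewrite [RHS]mupNroot //; apply/eqP; rewrite -leqn0 -[(_ <= _)%N]negbK -ltnNge.
  rewrite -has_count; apply/hasPn => y /flattenP[s /mapP[z zs ->]].
  rewrite mem_nseq => /andP[_ /eqP ->]; apply: contra rx => /eqP <-.
  by have := roots_on_rootsR A0 z; rewrite in_itv /= => ->.
rewrite -ms; elim: (rootsR p) us => //= y s IHs /andP[ys us].
rewrite inE count_cat => /orP[/eqP exy|xs].
  subst y; rewrite count_nseq /= eqxx mul1n (_ : count _ _ = 0)%N ?addn0 //.
  apply/eqP; rewrite -leqn0 -[(_ <= _)%N]negbK -ltnNge -has_count.
  apply/hasPn => z /flattenP[t /mapP[u us' ->]].
  rewrite mem_nseq => /andP[_ /eqP ->]; apply: contra ys => /eqP <-.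
  by [].
rewrite IHs // count_nseq /= (_ : (y == x) = false) ?mul0n //.
by apply: contraNF ys => /eqP ->.
Qed.

(** If this failed, a dimension count gives a nonzero [x] that lies in the span of the
    eigenvectors of [A] with large eigenvalues, in the span of those of [B] with
    small eigenvalues, and in the kernel of [A - B]; then [|xA| >= s|x|] and
    [|xB| < s|x|] although [xA = xB]. *)
Lemma eigenbasis_count_le n (A B : 'M[R]_n) U d V e (s : R) : 
  eigenbasis A U d -> eigenbasis B V e -> 0 <= s ->
  (\rank (A - B)%R <= 1)%N ->
  (#|[set i | (s <= `|d i|)%R]%SET| <= #|[set i | (s <= `|e i|)%R]%SET|.+1)%N.
Proof.
move=> [UU eA] [VV eB] s0 rk; rewrite leqNgt; apply/negP => lt.
set S := [set i | s <= `|d i|]%SET in lt.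
set S' := (~: [set i | s <= `|e i|])%SET.
have cS' : #|S'| = (n - #|[set i | (s <= `|e i|)%R]%SET|)%N by rewrite cardsCs finset.setCK card_ord.
have cSe : (#|[set i | (s <= `|e i|)%R]%SET| <= n)%N by rewrite -[n in X in (_ <= X)%N]card_ord max_card.
pose span (W : 'M[C]_n) (X : {set 'I_n}) := rowsub (@enum_val _ (mem X)) W.
have rspan W X : W *m map_mx Num.conj W^T = 1%:M -> \rank (span W X) = #|X|.
  move=> WW; apply: mxrank_unitary; apply/unitarymxP.
  apply/matrixP => i j; have := congr1 (fun M : 'M[C]_n => M (enum_val i) (enum_val j)) WW.
  rewrite !mxE (inj_eq enum_val_inj) => <-.
  by apply: eq_bigr => k _; rewrite !mxE.
pose K := kermx (map_mx toC (A - B)).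
have rK : (n.-1 <= \rank K)%N.
  by rewrite mxrank_ker mxrank_map; move: rk; move: (mxrank _) => r; clear; lia.
(* dimension of the intersection is at least |S| + |S'| - n - 1 > 0 *)
pose M1 := (span U S :&: span V S')%MS.
pose M := (M1 :&: K)%MS.
have M0 : M != 0.
  rewrite -mxrank_eq0 -lt0n.
  have := mxrank_sum_cap (span U S) (span V S').
  have := mxrank_sum_cap M1 K.
  rewrite (rspan _ _ UU) (rspan _ _ VV) -/M -/M1.
  have := rank_leq_col (span U S + span V S')%MS.
  have := rank_leq_col (M1 + K)%MS.
  move: lt rK cS' cSe (subset_leq_card (finset.subsetT S)); rewrite cardsT card_ord.
  move: (mxrank M) (mxrank M1) (mxrank K) (mxrank (_ + K)) (mxrank (_ + span V S')).
  move: #|_| #|S| #|S'|; clear; lia.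
have /rowV0Pn[x xM x0] := M0.
have xS : (x <= span U S)%MS by rewrite (submx_trans xM) // (submx_trans (capmxSl _ _)) // capmxSl.
have xS' : (x <= span V S')%MS by rewrite (submx_trans xM) // (submx_trans (capmxSl _ _)) // capmxSr.
have xK : x *m map_mx toC A = x *m map_mx toC B.
  apply/eqP; rewrite -subr_eq0 -mulmxBr -map_mxB; apply/eqP/sub_kermxP.
  by rewrite (submx_trans xM) // capmxSr.
pose nrm (y : 'rV[C]_n) := \sum_j `|y 0 j| ^+ 2.
have nrmE y : nrm y = (y *m map_mx Num.conj y^T) 0 0.
  by rewrite mxE; apply: eq_bigr => j _; rewrite !mxE normCK.
have nrmU (W : 'M[C]_n) y : W *m map_mx Num.conj W^T = 1%:M -> nrm (y *m W) = nrm y.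
  move=> WW; rewrite !nrmE trmx_mul map_mxM !mulmxA -[y *m W *m _]mulmxA WW mulmx1 //.
pose co (W : 'M[C]_n) := x *m map_mx Num.conj W^T.
have coK W : W *m map_mx Num.conj W^T = 1%:M -> co W *m W = x.
  by move=> WW; rewrite /co -mulmxA (mulmx1C WW) mulmx1.
have co0 W X j : W *m map_mx Num.conj W^T = 1%:M -> (x <= span W X)%MS -> j \notin X ->
    co W 0 j = 0.
  move=> WW /submxP[z ez] jX; rewrite /co ez -mulmxA mxE big1 // => k _.
  have := congr1 (fun M : 'M[C]_n => M (enum_val k) j) WW.
  rewrite !mxE => ee; rewrite (_ : \sum__ _ = 0) ?mulr0 //.
  transitivity ((enum_val k == j)%:R : C).
    by rewrite -ee; apply: eq_bigr => l _; rewrite !mxE.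
  by case: eqP => // ej; rewrite -ej enum_valP in jX.
have nco W : W *m map_mx Num.conj W^T = 1%:M -> nrm (co W) = nrm x.
  by move=> WW; rewrite -(nrmU W) // coK.
have nA (A' : 'M[R]_n) W f : eigenbasis A' W f ->
   nrm (x *m map_mx toC A') = \sum_j toC (`|f j| ^+ 2) * `|co W 0 j| ^+ 2.
  case=> WW ->; rewrite !mulmxA nrmU // -/(co W); apply: eq_bigr => j _.
  rewrite mul_mx_diag mxE !mxE normrM exprMn mulrC; congr (_ * _).
  by rewrite -normrX -rmorphXn /= real_normK ?num_real // normc_def /=
     expr0n /= addr0 sqrtr_sqr ger0_norm ?sqr_ge0.
have xpos : 0 < nrm x.
  have ge0 : 0 <= nrm x by apply: sumr_ge0 => j _; rewrite exprn_ge0.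
  rewrite lt_neqAle ge0 andbT eq_sym; apply: contra x0.
  rewrite psumr_eq0 => [/allP h|j _]; last by rewrite exprn_ge0.
  apply/eqP/rowP => j; have := h j; rewrite mem_index_enum => /(_ isT).
  by rewrite /= expf_eq0 /= normr_eq0 [RHS]mxE => /eqP.
have le : toC (s ^+ 2) * nrm x <= nrm (x *m map_mx toC A).
  rewrite (nA _ _ _ (conj UU eA)) -(nco _ UU) mulr_sumr; apply: ler_sum => j _.
  case: (boolP (j \in S)) => jS; last by rewrite (co0 _ _ _ UU xS jS) normr0 expr0n /= !mulr0.
  apply: ler_wpM2r; first by rewrite exprn_ge0.
  by rewrite lecR ler_sqr ?nnegrE //; move: jS; rewrite inE.
have : nrm (x *m map_mx toC B) < toC (s ^+ 2) * nrm x.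
  rewrite (nA _ _ _ (conj VV eB)) -(nco _ VV) mulr_sumr.
  have lej j : toC (`|e j| ^+ 2) * `|co V 0 j| ^+ 2 <= toC (s ^+ 2) * `|co V 0 j| ^+ 2
      ?= iff (co V 0 j == 0).
    case: (boolP (j \in S')) => jS; last first.
      by rewrite (co0 _ _ _ VV xS' jS) normr0 expr0n /= !mulr0 eqxx; apply/leif_refl.
    have ltj : `|e j| ^+ 2 < s ^+ 2.
      by rewrite ltr_sqr ?nnegrE //; move: jS; rewrite !inE -ltNge.
    case: (eqVneq (co V 0 j) 0) => [->|nz].
      by rewrite normr0 expr0n /= !mulr0; apply/leif_refl.
    suff lt' : toC (`|e j| ^+ 2) * `|co V 0 j| ^+ 2 < toC (s ^+ 2) * `|co V 0 j| ^+ 2.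
      by split; rewrite ?(ltW lt') // (lt_eqF lt').
    by rewrite ltr_pM2r ?ltcR // exprn_gt0 // normr_gt0.
  rewrite lt_neqAle ler_sum ?andbT => [|j _]; last by case: (lej j).
  have -> : (\sum_j toC (`|e j| ^+ 2) * `|co V 0 j| ^+ 2 == \sum_i toC (s ^+ 2) * `|co V 0 i| ^+ 2)
     = [forall j, co V 0 j == 0] by case: (leif_sum (fun j (_ : true) => lej j)).
  apply: contraTN xpos => /forallP h; rewrite -(nco _ VV) /nrm big1 ?ltxx // => j _.
  by rewrite (eqP (h j)) normr0 expr0n.
by rewrite -xK => /(le_lt_trans le); rewrite ltxx.
Qed.
End SpectralDecomposition.

Lemma sorted_second_largest (R : realDomainType) (L : seq R) (s : R) :
  sorted <=%R L -> (2 <= size L)%N ->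
  (s <= nth 0 L (size L - 2)) = (2 <= count (fun x => (s <= x)%R) L)%N.
Proof.
case/lastP: L => // L b; case/lastP: L => // t a.
rewrite !size_rcons subn2 /= !nth_rcons size_rcons ltnS leqnn ltnn eqxx.
rewrite -[rcons t a]cats1 -!cats1 -catA /= => srt _.
have /andP[st /allP ta] : (sorted <=%R t) && all (fun x => x <= a) t.
  move: srt; rewrite !(sorted_pairwise le_trans) pairwise_cat => /andP[/allrelP h /andP[h2 _]].
  rewrite h2; apply/allP => x xt; apply: h => //.
  by rewrite inE eqxx.
have ab : a <= b.
  move: srt; rewrite (sorted_pairwise le_trans) pairwise_cat => /and3P[_ _].
  by rewrite /= !andbT.
rewrite count_cat /=; case: (lerP s a) => [sa|sa]; first by rewrite (le_trans sa ab) !addnS.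
rewrite (_ : count _ _ = 0)%N; first by case: (s <= b).
apply/eqP; rewrite -leqn0 -[(_ <= _)%N]negbK -ltnNge -has_count.
by apply/hasPn => x xt; rewrite -ltNge (le_lt_trans (ta x xt)).
Qed.

Section SecondSingularValue.
Variable R : rcfType.

Definition abs_count n (d : 'I_n -> R) s := #|[set i | (s <= `|d i|)%R]%SET|.

Lemma singular_values_perm n (A : 'M[R]_n) U d : eigenbasis A U d ->
  perm_eq (singular_values A) [seq `|d i| | i <- enum 'I_n].
Proof.
move=> /eigenbasis_char_poly/eigenvalues_perm h.
by rewrite /singular_values perm_sort [X in perm_eq _ X]map_comp perm_map.
Qed.

Lemma size_singular_values n (A : 'M[R]_n) : A^T = A -> size (singular_values A) = n.
Proof.
move=> /symmetric_eigenbasis[U [d h]].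
by rewrite (perm_size (singular_values_perm h)) size_map -cardE card_ord.
Qed.

Lemma singular_values_sorted n (A : 'M[R]_n) : sorted <=%R (singular_values A).
Proof. by apply: sort_sorted; apply: le_total. Qed.

Lemma second_singular_value_ge n (A : 'M[R]_n) U d s : eigenbasis A U d ->
  A^T = A -> (2 <= n)%N ->
  (s <= second_singular_value A) = (1 < abs_count d s)%N.
Proof.
move=> h sA n2; rewrite /second_singular_value.
have := sorted_second_largest s (singular_values_sorted A).
rewrite size_singular_values // => -> //; congr (_ < _)%N.
rewrite (permP (singular_values_perm h)) count_map /abs_count.
by rewrite -sum1_count big_enum_cond /= -sum1dep_card; apply: eq_bigl.
Qed.

Lemma sum_singular_values n (A : 'M[R]_n) U d k : eigenbasis A U d ->
  \tr (A ^+ (2 * k)) = \sum_(x <- singular_values A) x ^+ (2 * k).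
Proof.
move=> h; rewrite (eigenbasis_mxtraceX _ h) (perm_big _ (singular_values_perm h)) /=.
rewrite big_map big_enum /=; apply: eq_bigr => i _.
by rewrite !exprM real_normK ?num_real.
Qed.

(** A rank one perturbation lets at most one singular value of [A] exceed the
    operator norm of [B], and an even power trace dominates every eigenvalue. *)
Lemma second_singular_value_lt n (A B : 'M[R]_n) k s : A^T = A -> B^T = B ->
  (2 <= n)%N -> (\rank (A - B)%R <= 1)%N -> 0 <= s ->
  \tr (B ^+ (2 * k)) < s ^+ (2 * k) -> second_singular_value A < s.
Proof.
move=> sA sB n2 rk s0; have [U [d hA]] := symmetric_eigenbasis sA.
have [V [e hB]] := symmetric_eigenbasis sB.
rewrite (eigenbasis_mxtraceX _ hB) => lt.
rewrite ltNge (second_singular_value_ge _ hA) // -ltnNge.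
apply: leq_trans (eigenbasis_count_le hA hB s0 rk) _; rewrite ltnS leqn0.
rewrite cards_eq0; apply/eqP/setP => i; rewrite !inE; apply/negbTE.
rewrite -ltNge ltNge; apply/negP => le; move: lt; rewrite ltNge => /negP; apply.
rewrite (bigD1 i) //= -[leLHS]addr0; apply: lerD.
  by rewrite !exprM -(real_normK (num_real (e i))) lerXn2r ?nnegrE ?exprn_ge0 ?lerXn2r ?nnegrE.
by apply: sumr_ge0 => j _; rewrite exprM exprn_ge0 ?sqr_ge0.
Qed.

(** If at most two eigenvalues of [B] had modulus at least [s], the trace of
    [B ^+ (2 * k)] would be at most [n s^2k] plus two terms bounded by the operator
    norm; so there are three, and a rank one perturbation keeps two of them. *)
Lemma second_singular_value_lower n (A B : 'M[R]_n) k l s b : A^T = A -> B^T = B ->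
  (2 <= n)%N -> (\rank (A - B)%R <= 1)%N -> 0 <= s -> 0 <= b ->
  \tr (B ^+ (2 * l)) < b ^+ (2 * l) ->
  n%:R * s ^+ (2 * k) + 2 * b ^+ (2 * k) < \tr (B ^+ (2 * k)) ->
  s <= second_singular_value A.
Proof.
move=> sA sB n2 rk s0 b0; have [U [d hA]] := symmetric_eigenbasis sA.
have [V [e hB]] := symmetric_eigenbasis sB.
rewrite !(eigenbasis_mxtraceX _ hB) => ltb lt.
rewrite (second_singular_value_ge _ hA) // -ltnS.
have rk' : (\rank (B - A)%R <= 1)%N by rewrite -opprB mxrank_opp.
apply: leq_trans (eigenbasis_count_le hB hA s0 rk').
rewrite ltnNge; apply/negP => le2; move: lt; rewrite ltNge => /negP; apply.
have eb i : `|e i| <= b.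
  rewrite leNgt; apply/negP => lt; move: ltb; rewrite ltNge => /negP; apply.
  rewrite (bigD1 i) //= -[leLHS]addr0; apply: lerD.
    by rewrite !exprM -(real_normK (num_real (e i))) lerXn2r ?nnegrE ?exprn_ge0 ?lerXn2r ?nnegrE ?(ltW lt).
  by apply: sumr_ge0 => j _; rewrite exprM exprn_ge0 ?sqr_ge0.
set S := [set i | _]%SET in le2.
have ex i : e i ^+ (2 * k) = `|e i| ^+ (2 * k) by rewrite !exprM real_normK ?num_real.
rewrite (bigID (mem S)) /= addrC; apply: lerD.
  rewrite -[n in n%:R]card_ord -sum1_card natr_sum mulr_suml.
  rewrite [leRHS](bigID (mem S)) /= addrC -[leLHS]addr0; apply: lerD; last first.
    by apply: sumr_ge0 => i _; rewrite mul1r exprn_ge0.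
  apply: ler_sum => i; rewrite inE -ltNge mul1r => lti.
  by rewrite ex lerXn2r ?nnegrE ?(ltW lti).
apply: (@le_trans _ _ (\sum_(i in S) b ^+ (2 * k))).
  by apply: ler_sum => i _; rewrite ex lerXn2r ?nnegrE.
by rewrite sumr_const -[leLHS]mulr_natl ler_wpM2r ?exprn_ge0 // ler_nat.
Qed.
End SecondSingularValue.

(** * Singular values as functions of the traces of powers *)

Lemma bernoulli_le (R : realDomainType) (r : R) k : 0 <= r -> 1 + k%:R * r <= (1 + r) ^+ k.
Proof.
move=> r0; elim: k => [|k IHk]; first by rewrite mul0r addr0 expr0.
rewrite exprSr (le_trans _ (ler_wpM2r _ IHk)) ?addr_ge0 //.
have : 0 <= k%:R * r * r by rewrite !mulr_ge0.
rewrite -natr1; lra.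
Qed.

Section TracesDetermineSingularValues.
Variable R : realType.

Lemma ge0_le_of_pow_le (C x t : R) : 0 <= x -> 0 <= t ->
  (forall k, x ^+ (2 * k) <= C * t ^+ (2 * k)) -> x <= t.
Proof.
move=> x0 t0 h; rewrite leNgt; apply/negP => tx.
case: (ltgtP t 0) t0 => // [tp|t0'] _; last first.
  have := h 1%N; rewrite t0' expr0n /= mulr0; apply/negP; rewrite -ltNge exprn_gt0 //.
  by rewrite -t0'.
have r0 : 0 < x / t - 1 by rewrite subr_gt0 ltr_pdivlMr // mul1r.
have [k hk] : exists k : nat, C / (x / t - 1) < k%:R.
  by exists (Num.truncn (C / (x / t - 1))).+1; rewrite truncnS_gt.
have hC : C < (x / t) ^+ (2 * k).
  apply: (@lt_le_trans _ _ (1 + (2 * k)%:R * (x / t - 1))).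
    rewrite ltr_pdivrMr // in hk; rewrite natrM.
    have : 0 <= k%:R * (x / t - 1) by rewrite mulr_ge0 // ltW.
    lra.
  have {2}-> : x / t = 1 + (x / t - 1) by rewrite addrC subrK.
  by apply: bernoulli_le; apply: ltW.
have := h k; apply/negP; rewrite -ltNge.
by move: hC; rewrite expr_div_n ltr_pdivlMr // exprn_gt0.
Qed.

Definition largest_singular_value n (A : 'M[R]_n) := nth 0 (singular_values A) (n - 1).

Lemma singular_values_split n (A : 'M[R]_n) : A^T = A -> (2 <= n)%N ->
  exists t : seq R, [/\ singular_values A =
      rcons (rcons t (second_singular_value A)) (largest_singular_value A),
    size t = (n - 2)%N,
    forall x, x \in t -> 0 <= x <= second_singular_value A,
    0 <= second_singular_value A & second_singular_value A <= largest_singular_value A].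
Proof.
move=> sA n2; have := size_singular_values sA; have := singular_values_sorted A.
have : all (fun x => 0 <= x) (singular_values A).
  rewrite /singular_values all_sort all_map; apply/allP => x _ /=; exact: normr_ge0.
rewrite /second_singular_value /largest_singular_value.
move: (singular_values A) => L /allP pos srt sz.
have {}pos x : x \in L -> 0 <= x by exact: pos.
case/lastP: L pos srt sz => [|L b]; first by move=> _ _ /= e; rewrite -e in n2.
case/lastP: L => [|t a]; first by move=> _ _ /= e; rewrite -e in n2.
rewrite !size_rcons => pos srt sz.
rewrite (_ : n - 2 = size t)%N; last by rewrite -sz subn2.
rewrite (_ : n - 1 = (size t).+1)%N; last by rewrite -sz subn1.
rewrite !nth_rcons size_rcons ltnS leqnn !ltnn !eqxx.
move: srt; rewrite (sorted_pairwise le_trans) -cats1 pairwise_cat.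
move=> /and3P[/allrelP h1 h2 _]; move: h2; rewrite -cats1 pairwise_cat.
move=> /and3P[/allrelP h2 _ _].
exists t; split => [|//|x xt||]; first by rewrite ?cats1.
- by apply/andP; split; [apply: pos; rewrite !(mem_rcons, inE) xt !orbT|apply: h2; rewrite ?inE].
- by apply: pos; rewrite !(mem_rcons, inE) eqxx orbT.
- by apply: h1; rewrite !(mem_rcons, inE) eqxx.
Qed.

Lemma mxtrace_singular_values n (A : 'M[R]_n) k : A^T = A ->
  \tr (A ^+ (2 * k)) = \sum_(x <- singular_values A) x ^+ (2 * k).
Proof. by move=> /symmetric_eigenbasis[U [d h]]; exact: sum_singular_values h. Qed.

(** Together with [singular_value_product_le] this describes the two largest
    singular values by countably many inequalities between polynomials in the
    entries, which is how they are shown to be measurable. *)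
Lemma largest_singular_value_le n (A : 'M[R]_n) t : A^T = A -> (2 <= n)%N -> 0 <= t ->
  (largest_singular_value A <= t) <->
  (forall k, \tr (A ^+ (2 * k)) <= n%:R * t ^+ (2 * k)).
Proof.
move=> sA n2 t0; have [s [e sz st ap ab]] := singular_values_split sA n2.
have bp := le_trans ap ab; split => [bt k|h].
  rewrite mxtrace_singular_values //.
  apply: (@le_trans _ _ (\sum_(x <- singular_values A) t ^+ (2 * k))).
    rewrite big_seq [leRHS]big_seq; apply: ler_sum => x.
    rewrite e !(mem_rcons, inE) => xs; suff /andP[x0 xt] : 0 <= x <= t by rewrite lerXn2r ?nnegrE.
    case/or3P: xs => [/eqP ->|/eqP ->|/st /andP[-> /= xa]]; rewrite ?bp ?ap //=.
      exact: le_trans ab bt.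
    exact: (le_trans xa (le_trans ab bt)).
  by rewrite big_const_seq count_predT iter_addr_0 size_singular_values // mulr_natl.
apply: (@ge0_le_of_pow_le n%:R) => // k; apply: le_trans (h k).
rewrite mxtrace_singular_values // e -cats1 big_cat big_seq1 /=.
by rewrite lerDr sumr_ge0 // => x _; rewrite exprM exprn_ge0 ?sqr_ge0.
Qed.

(** The difference of traces is the sum of [(s_i s_j)^2k] over ordered pairs of distinct
    indices, so it grows like the power of the largest product. *)
Lemma singular_value_product_le n (A : 'M[R]_n) t : A^T = A -> (2 <= n)%N -> 0 <= t ->
  (largest_singular_value A * second_singular_value A <= t) <->
  (forall k, \tr (A ^+ (2 * k)) ^+ 2 - \tr (A ^+ (2 * (2 * k))) <= n%:R ^+ 2 * t ^+ (2 * k)).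
Proof.
move=> sA n2 t0; have [s [e sz st a0 ab]] := singular_values_split sA n2.
set a := second_singular_value A in e st a0 ab *.
set b := largest_singular_value A in e ab *.
have b0 := le_trans a0 ab.
pose X k := \sum_(x <- s) x ^+ (2 * k).
have X0 k : 0 <= X k by apply: sumr_ge0 => x _; rewrite exprM exprn_ge0 ?sqr_ge0.
have trE k : \tr (A ^+ (2 * k)) = X k + a ^+ (2 * k) + b ^+ (2 * k).
  by rewrite mxtrace_singular_values // e -!cats1 !big_cat !big_seq1.
have e2 k (x : R) : x ^+ (2 * (2 * k)) = (x ^+ (2 * k)) ^+ 2.
  by rewrite -exprM mulnC.
have XX k : X (2 * k)%N <= X k ^+ 2.
  rewrite /X; elim: (s) => [|x s' IH]; first by rewrite !big_nil expr0n.
  rewrite !big_cons e2.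
  have h1 : 0 <= x ^+ (2 * k) by rewrite exprM exprn_ge0 ?sqr_ge0.
  have h2 : 0 <= \sum_(x <- s') x ^+ (2 * k).
    by apply: sumr_ge0 => y _; rewrite exprM exprn_ge0 ?sqr_ge0.
  have := mulr_ge0 h1 h2; move: IH.
  move: (\sum_(x <- s') x ^+ (2 * k)) h2 => u h2; move: (\sum_(x <- s') _) => w.
  rewrite !expr2; nra.
have Xa k : X k <= (n - 2)%:R * a ^+ (2 * k).
  rewrite -sz /X -sum1_size natr_sum mulr_suml big_seq [leRHS]big_seq; apply: ler_sum => x xs.
  by have /andP[x0 xa] := st x xs; rewrite mul1r lerXn2r ?nnegrE.
have m0 : (0 : R) <= (n - 2)%:R by [].
have -> : n%:R = (n - 2)%:R + 2 :> R by rewrite natrB // subrK.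
move: ((n - 2)%:R : R) m0 Xa => m m0 Xa.
have eqk k : \tr (A ^+ (2 * k)) ^+ 2 - \tr (A ^+ (2 * (2 * k))) =
   (X k ^+ 2 - X (2 * k)%N) + 2 * X k * (a ^+ (2 * k) + b ^+ (2 * k)) + 2 * (b * a) ^+ (2 * k).
  by rewrite !trE !e2 exprMn; ring.
split => [bt k|h].
  rewrite eqk; apply: (@le_trans _ _ ((m + 2) ^+ 2 * (b * a) ^+ (2 * k))); last first.
    by rewrite ler_wpM2l ?sqr_ge0 // lerXn2r ?nnegrE // mulr_ge0.
  have := Xa k; have := X0 k; have := X0 (2 * k)%N; rewrite exprMn.
  have : a ^+ (2 * k) <= b ^+ (2 * k) by rewrite lerXn2r ?nnegrE.
  have : 0 <= a ^+ (2 * k) by rewrite exprn_ge0.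
  move: (a ^+ _) (b ^+ _) (X k) (X _) => al be x y al0 albe y0 x0 xle.
  have h1 : x ^+ 2 <= m * al * (m * be).
    by rewrite expr2 ler_pM // (le_trans xle) // ler_wpM2l.
  have h2 : x * (al + be) <= m * al * (be + be).
    by rewrite ler_pM ?addr_ge0 ?lerD //; lra.
  rewrite !expr2 in h1 *; nra.
apply: (@ge0_le_of_pow_le ((m + 2) ^+ 2)) => // [|k]; first by rewrite mulr_ge0.
apply: le_trans (h k); rewrite eqk.
have h1 : 0 <= (b * a) ^+ (2 * k) by rewrite exprn_ge0 // mulr_ge0.
have h2 : 0 <= 2 * X k * (a ^+ (2 * k) + b ^+ (2 * k)).
  by rewrite !mulr_ge0 ?addr_ge0 ?exprn_ge0.
have := XX k; lra.
Qed.
End TracesDetermineSingularValues.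

(** * Moments of traces as sums over walks *)

Section Walks.
Variables (R : realFieldType) (N : nat).
Local Notation V := 'I_N.
Local Notation edge := (V * V)%type.
Implicit Types (h : seq edge) (i j u : V) (e f : edge).

(** A symmetric matrix has the same entry at [(i, j)] and at [(j, i)], so a step is
    recorded by the position on or above the diagonal, where the entries of the
    ensemble are independent. *)
Definition ed i j : edge := if (i <= j)%N then (i, j) else (j, i).
Definition touches u e := (e.1 == u) || (e.2 == u).

Lemma edC i j : ed i j = ed j i.
Proof. by rewrite /ed; case: ltngtP => // /val_inj ->. Qed.

Lemma touches_ed u i j : touches u (ed i j) = (u == i) || (u == j).
Proof. by rewrite /touches /ed; case: ifP => _ /=; rewrite ![_ == u]eq_sym // orbC. Qed.

Lemma ed_inj i : injective (ed i).
Proof.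
move=> j k; rewrite /ed; case: ifP => ij; case: ifP => ik [] //.
- by move=> -> ->.
- by move=> -> ->.
Qed.

Definition moment_weight (w : nat -> R) h := \prod_e w (count_mem e h).

(** Equals the expectation of [\prod_(e <- h) W_e * (W ^+ n) i j] when the entries
    of [W] on and above the diagonal are independent with moments [mom]; see
    [expect_walk].  The history [h] has to be carried along because an expectation
    factorizes only when all multiplicities are known. *)
Fixpoint walk_sum (mom : nat -> R) n h i j : R :=
  if n is n'.+1 then \sum_k walk_sum mom n' (ed i k :: h) k j
  else (i == j)%:R * moment_weight mom h.

Definition single (Q : pred edge) h : nat := \sum_e ((count_mem e h == 1%N) && Q e).

Lemma count_mem_cons e f h : count_mem e (f :: h) = ((f == e) + count_mem e h)%N.
Proof. by []. Qed.

Lemma count_mem_other e f h : e != f -> count_mem e (f :: h) = count_mem e h.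
Proof. by rewrite count_mem_cons; case: (eqVneq f e) => // fe; rewrite fe eqxx in ef. Qed.

Lemma single_cons Q f h : 
  (single Q (f :: h) + ((count_mem f h == 1%N) && Q f) =
  single Q h + ((count_mem f h == 0%N) && Q f))%N.
Proof.
rewrite /single (bigD1 f) // [in RHS](bigD1 f) // count_mem_cons eqxx.
rewrite (eq_bigr (fun e => nat_of_bool ((count_mem e h == 1%N) && Q e))); last first.
  by move=> e ef; rewrite count_mem_other.
move: (\sum_(_ | _) _)%N (count _ _) => S c.
by case: c => [|[|c]] /=; case: (Q f) => /=; lia.
Qed.

Definition deg h u := single (touches u) h.
(** A walk that explores a tree leaves behind vertices with two edges of
    multiplicity one, the way in and the way out, and stands at a vertex with one.
    The excess over these numbers bounds how often the walk may still face a
    choice when it goes back along an edge of multiplicity one. *)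
Definition excess h i : nat := \sum_u (deg h u - (if u == i then 1 else 2)).

Lemma sum_count_mem h : (\sum_e count_mem e h = size h)%N.
Proof.
elim: h => [|f h IH]; first by rewrite big1.
under eq_bigr do rewrite count_mem_cons.
rewrite big_split /= IH (bigD1 f) //= eqxx big1 ?addn0 // => e ef.
by case: (eqVneq f e) => // fe; rewrite fe eqxx in ef.
Qed.

Lemma single_le_size Q h : (single Q h <= size h)%N.
Proof.
rewrite -sum_count_mem; apply: leq_sum => e _.
by case: eqP => [->|] //=; case: (Q e).
Qed.

Definition is_new h i j := (j != i) && ~~ has (touches j) h.

Lemma is_new_count h i j : is_new h i j -> count_mem (ed i j) h = 0%N.
Proof.
case/andP=> _ /hasPn nh; apply/count_memPn/negP => /nh.
by rewrite touches_ed eqxx orbT.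
Qed.

Lemma is_new_deg h i j : is_new h i j -> deg h j = 0%N.
Proof.
case/andP=> _ /hasPn nh; apply: big1 => e _.
case: (boolP (e \in h)) => [/nh/negbTE ->|/count_memPn -> //]; by rewrite andbF.
Qed.

Lemma card_not_new h i : (#|[set j | ~~ is_new h i j]%SET| <= (2 * size h).+1)%N.
Proof.
apply: (@leq_trans (size (i :: map fst h ++ map snd h))); last first.
  by rewrite /= size_cat !size_map mul2n addnn.
apply: leq_trans (card_size _); apply: subset_leq_card; apply/fintype.subsetP => j.
rewrite !inE /is_new negb_and !negbK => /orP[->//|/hasP[e eh]].
rewrite mem_cat; case/orP => /eqP <-; first by rewrite map_f ?orbT.
by rewrite (map_f snd) ?orbT.
Qed.

(** Going back along a given edge determines the next vertex. *)
Lemma card_closing h i : (#|[set j | count_mem (ed i j) h == 1%N]%SET| <= deg h i)%N.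
Proof.
rewrite -(card_imset _ (@ed_inj i)) /deg /single.
have -> : (\sum_e ((count_mem e h == 1%N) && touches i e) =
   #|[set e | (count_mem e h == 1%N) && touches i e]%SET|)%N.
  by rewrite -sum1dep_card [RHS]big_mkcond; apply: eq_bigr => e _; case: (_ && _).
apply: subset_leq_card; apply/fintype.subsetP => e /imsetP[j]; rewrite !inE => cj ->.
by rewrite cj touches_ed eqxx.
Qed.

(** The current vertex gains its way out just when its allowance grows from one to
    two, and the new vertex has its way in as its only edge. *)
Lemma excess_new h i j : is_new h i j -> excess (ed i j :: h) j = excess h i.
Proof.
move=> nj; apply: eq_bigr => u _; have dj := is_new_deg nj.
have := single_cons (touches u) (ed i j) h; rewrite is_new_count //= touches_ed.
rewrite -!/(deg _ _) /=; case: (eqVneq u j) => [->|uj].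
  rewrite (is_new_deg nj); case/andP: nj => /negbTE -> _ /=; lia.
by case: (eqVneq u i) => _ /=; lia.
Qed.

(** An ambiguous return is paid for: the current vertex loses an edge of
    multiplicity one, and leaving it raises its allowance. *)
Lemma excess_closing h i j : count_mem (ed i j) h = 1%N ->
  (excess (ed i j :: h) j + (2 <= deg h i) <= excess h i)%N.
Proof.
move=> c1; pose b u := if u == i then (2 <= deg h i : nat) else 0%N.
have -> : nat_of_bool (2 <= deg h i)%N = (\sum_u b u)%N.
  by rewrite /b -big_mkcond big_pred1_eq.
rewrite -big_split; apply: leq_sum => u _; rewrite /b /=.
have := single_cons (touches u) (ed i j) h; rewrite c1 /= touches_ed -!/(deg _ _).
case: (eqVneq u i) => [->|ui]; case: (eqVneq _ j) => [_|uj] /=; try lia.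
Qed.

Lemma excess_any h i j : count_mem (ed i j) h != 1%N ->
  (excess (ed i j :: h) j <= excess h i + 2)%N.
Proof.
move=> c1; pose b u := if u == j then 2%N else 0%N.
have -> : 2%N = (\sum_u b u)%N by rewrite /b -big_mkcond big_pred1_eq.
rewrite -big_split; apply: leq_sum => u _; rewrite /b /=.
have := single_cons (touches u) (ed i j) h; rewrite (negbTE c1) /= touches_ed -!/(deg _ _).
case: (eqVneq u i) => [->|ui]; case: (eqVneq _ j) => [_|uj] /=; case: eqP => _ /=; lia.
Qed.

Variables (mom : nat -> R) (sg K r : R) (l : nat).
Hypotheses (sg0 : 0 <= sg) (sgK : sg <= K) (r1 : 1 <= r) (rN : r ^+ 2 = N%:R) (l0 : (0 < l)%N).
Hypotheses (mom0 : mom 0 = 1) (mom1 : mom 1 = 0)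
  (mom2 : forall m, `|mom m.+2| <= sg ^+ 2 * K ^+ m).

(** Bounds [`|mom m|] except that [omega 1] is not [0]: an edge crossed once may be
    crossed again later, so each of the first two crossings is charged [sg]. *)
Definition omega m : R := match m with 0 => 1 | 1 => sg | m'.+2 => sg ^+ 2 * K ^+ m' end.
Definition Omega h := moment_weight omega h.
(** Upper bound for the mean of the edges in [h], discounted so that the sum over the
    next step grows by at most [walk_rate].  An edge of multiplicity one costs
    [1 / r], since opening it has [r ^+ 2] choices and closing it only one; with
    this discount both contribute [sg * r].  A unit of excess is worth [l], the
    number of choices that it may cause later. *)
Definition potential h i : R :=
  l%:R ^+ excess h i * (r^-1 ^+ single predT h * Omega h).

Let K0 : 0 <= K. Proof. exact: le_trans sgK. Qed.
Let r0 : 0 < r. Proof. exact: lt_le_trans r1. Qed.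
Let ri0 : 0 <= r^-1. Proof. by rewrite invr_ge0 ltW. Qed.
Let ri1 : r^-1 <= 1. Proof. by rewrite invf_le1. Qed.
Let l1 : 1 <= l%:R :> R. Proof. by rewrite ler1n. Qed.

Lemma omega_ge0 m : 0 <= omega m.
Proof. by case: m => [|[|m]] //=; rewrite mulr_ge0 ?exprn_ge0. Qed.

Lemma Omega_ge0 h : 0 <= Omega h.
Proof. by apply: prodr_ge0 => e _; exact: omega_ge0. Qed.

Lemma omegaS m : omega m.+1 = omega m * (if (m < 2)%N then sg else K).
Proof.
case: m => [|[|m]] /=; rewrite ?mul1r ?expr0 ?mulr1 //.
by rewrite (exprSr K) mulrA.
Qed.

Lemma Omega_cons f h : Omega (f :: h) = Omega h * (if (count_mem f h < 2)%N then sg else K).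
Proof.
rewrite /Omega /moment_weight (bigD1 f) // [in RHS](bigD1 f) // count_mem_cons eqxx add1n omegaS.
rewrite (eq_bigr (fun e => omega (count_mem e h))) => [|e ef].
  by rewrite /= mulrAC.
by rewrite count_mem_other.
Qed.

Lemma potential_ge0 h i : 0 <= potential h i.
Proof. by rewrite !mulr_ge0 ?exprn_ge0 ?Omega_ge0. Qed.

Lemma potential_new h i j : is_new h i j ->
  potential (ed i j :: h) j = potential h i * (sg / r).
Proof.
move=> nj; rewrite /potential excess_new // Omega_cons is_new_count //=.
have := single_cons predT (ed i j) h; rewrite is_new_count //= addn0 addn1 => ->.
rewrite exprS; ring.
Qed.

Lemma potential_closing h i j : count_mem (ed i j) h = 1%N ->
  potential (ed i j :: h) j * l%:R ^+ (2 <= deg h i)%N <= potential h i * (sg * r).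
Proof.
move=> c1; rewrite /potential Omega_cons c1 /=.
have := single_cons predT (ed i j) h; rewrite c1 /= addn0 addn1 => <-.
set s := single _ _; set o := Omega h.
rewrite mulrAC -exprD exprS.
have -> : l%:R ^+ excess h i * (r^-1 * r^-1 ^+ s * o) * (sg * r) =
   l%:R ^+ excess h i * (r^-1 ^+ s * (o * sg)) by field; rewrite gt_eqF.
apply: ler_wpM2r; first by rewrite !mulr_ge0 ?exprn_ge0 ?Omega_ge0.
by apply: ler_weXn2l => //; apply: excess_closing.
Qed.

Lemma potential_any h i j : count_mem (ed i j) h != 1%N ->
  potential (ed i j :: h) j <= potential h i * (l%:R ^+ 2 * K).
Proof.
move=> c1; rewrite /potential Omega_cons.
have := single_cons predT (ed i j) h; rewrite (negbTE c1) /= addn0 andbT => ->.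
set s := single _ _; set o := Omega h; have o0 : 0 <= o := Omega_ge0 h.
have -> : l%:R ^+ excess h i * (r^-1 ^+ s * o) * (l%:R ^+ 2 * K) =
  l%:R ^+ (excess h i + 2)%N * (r^-1 ^+ s * (o * K)) by rewrite exprD; ring.
set x := (if _ then sg else K); have x0 : 0 <= x by rewrite /x; case: ifP.
have xK : x <= K by rewrite /x; case: ifP.
have rn n : 0 <= r^-1 ^+ n by rewrite exprn_ge0.
have ln n : 0 <= l%:R ^+ n :> R by rewrite exprn_ge0.
have ox : 0 <= o * x by rewrite mulr_ge0.
apply: ler_pM => //; first by rewrite mulr_ge0.
  by apply: ler_weXn2l => //; apply: excess_any.
apply: ler_pM => //; first by apply: ler_wiXn2l => //; rewrite leq_addr.
exact: ler_wpM2l.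
Qed.

Definition exceptional h i j := ~~ is_new h i j && (count_mem (ed i j) h != 1%N).
Definition exceptional_cost : R := (2 * l).+1%:R * (l%:R ^+ 2 * K).

Lemma exceptional_cost_ge0 : 0 <= exceptional_cost.
Proof. by rewrite !mulr_ge0 ?exprn_ge0. Qed.

(** At most [2 * l + 1] vertices are old, against [r ^+ 2] new ones. *)
Lemma sum_exceptional h i : (size h <= l)%N ->
  \sum_(j | exceptional h i j) potential (ed i j :: h) j <= potential h i * exceptional_cost.
Proof.
move=> hl; apply: (@le_trans _ _ (\sum_(j | exceptional h i j) potential h i * (l%:R ^+ 2 * K))).
  by apply: ler_sum => j /andP[_ c1]; exact: potential_any.
rewrite sumr_const -[leLHS]mulr_natl /exceptional_cost.
rewrite [leLHS]mulrCA; apply: ler_wpM2l; first exact: potential_ge0.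
apply: ler_wpM2r; first by rewrite mulr_ge0 ?exprn_ge0.
rewrite ler_nat; apply: (@leq_trans (2 * size h).+1); last by rewrite ltnS leq_mul.
apply: leq_trans (card_not_new h i); apply: subset_leq_card; apply/fintype.subsetP => j.
by rewrite !inE => /andP[].
Qed.

(** If the return is ambiguous, the number of choices is at most [l] and is
    cancelled by the drop of the excess. *)
Lemma sum_closing h i : (size h <= l)%N ->
  \sum_(j | count_mem (ed i j) h == 1%N) potential (ed i j :: h) j <= potential h i * (sg * r).
Proof.
move=> hl; set b := l%:R ^+ (2 <= deg h i)%N : R.
have b0 : 0 < b by rewrite exprn_gt0 // (lt_le_trans _ l1).
apply: (@le_trans _ _ (\sum_(j | count_mem (ed i j) h == 1%N) potential h i * (sg * r) / b)).
  apply: ler_sum => j /eqP c1; rewrite ler_pdivlMr //; exact: potential_closing.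
rewrite sumr_const -[leLHS]mulr_natl.
have p0 : 0 <= potential h i * (sg * r).
  by apply: mulr_ge0; [exact: potential_ge0|apply: mulr_ge0 => //; exact: ltW].
rewrite mulrCA -[leRHS]mulr1; apply: ler_wpM2l => //.
rewrite ler_pdivrMr // mul1r; apply: (@le_trans _ _ (deg h i)%:R).
  rewrite ler_nat; apply: leq_trans (card_closing h i); rewrite cardsE.
  by apply: subset_leq_card; apply/fintype.subsetP.
rewrite /b; case: ltnP => /= d2; last by rewrite expr0 -[1]/(1%:R) ler_nat.
by rewrite expr1 ler_nat (leq_trans (single_le_size _ _)).
Qed.

Lemma sum_new h i : 
  \sum_(j | is_new h i j) potential (ed i j :: h) j <= potential h i * (sg * r).
Proof.
rewrite (eq_bigr (fun=> potential h i * (sg / r))); last by move=> j; exact: potential_new.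
rewrite sumr_const -[leLHS]mulr_natl.
have p0 : 0 <= potential h i * sg by apply: mulr_ge0 => //; exact: potential_ge0.
have -> : potential h i * (sg * r) = r ^+ 2 * (potential h i * (sg / r)).
  by rewrite expr2; field; rewrite gt_eqF.
rewrite rN; apply: ler_wpM2r; first by rewrite mulrA mulr_ge0.
by rewrite ler_nat -[leqRHS]card_ord max_card.
Qed.

Definition walk_rate : R := 2 * (sg * r) + exceptional_cost.

(** An edge of multiplicity one makes the mean vanish, so the discount for open
    edges is harmless at the end of the walk. *)
Lemma moment_weight_le h i : `|moment_weight mom h| <= potential h i.
Proof.
have mle m : `|mom m| <= omega m.
  by case: m => [|[|m]]; rewrite ?mom0 ?mom1 ?normr1 ?normr0 //=.
have le1 : 1 <= l%:R ^+ excess h i :> R by rewrite exprn_ege1.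
case: (posnP (single predT h)) => [e0|].
  rewrite /potential e0 expr0 mul1r; apply: (@le_trans _ _ (Omega h)).
    rewrite normr_prod; apply: ler_prod => e _; by rewrite normr_ge0 mle.
  by rewrite ler_peMl ?Omega_ge0.
rewrite lt0n sum_nat_eq0 negb_forall => /existsP[e].
rewrite /= andbT eqb0 negbK => /eqP c1.
by rewrite /moment_weight (bigD1 e) //= c1 mom1 mul0r normr0 potential_ge0.
Qed.

Lemma sum_potential h i : (size h <= l)%N ->
  \sum_j potential (ed i j :: h) j <= potential h i * walk_rate.
Proof.
move=> hl; rewrite (bigID (is_new h i)) /= /walk_rate.
rewrite (bigID [pred j | count_mem (ed i j) h == 1%N] [pred j | ~~ is_new h i j]) /=.
have -> : 2 * (sg * r) + exceptional_cost = sg * r + (sg * r + exceptional_cost) by ring.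
rewrite mulrDr [X in _ <= _ + X]mulrDr; apply: lerD; first exact: sum_new.
apply: lerD; last exact: sum_exceptional.
apply: le_trans (sum_closing i hl).
rewrite [leLHS]big_mkcond [leRHS]big_mkcond; apply: ler_sum => j _.
by case: (count_mem _ _ == _); rewrite ?andbF // andbT; case: ifP; rewrite // potential_ge0.
Qed.

Lemma walk_rate_ge0 : 0 <= walk_rate.
Proof. by rewrite addr_ge0 ?exceptional_cost_ge0 // !mulr_ge0 // ltW. Qed.

(** Every step multiplies the potential by at most [walk_rate], whatever the history,
    so the walks need not be sorted by their shapes. *)
Lemma walk_sum_le n h i j : (size h + n <= l)%N ->
  `|walk_sum mom n h i j| <= potential h i * walk_rate ^+ n.
Proof.
elim: n h i => [|n IHn] h i hl /=.
  rewrite expr0 mulr1 normrM; apply: le_trans (moment_weight_le h i).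
  by case: eqP => _; rewrite ?normr1 ?mul1r // normr0 mul0r.
apply: le_trans (ler_norm_sum _ _ _) _.
apply: (@le_trans _ _ (\sum_k potential (ed i k :: h) k * walk_rate ^+ n)).
  by apply: ler_sum => k _; apply: IHn; rewrite /= addSnnS.
rewrite -mulr_suml exprS mulrA ler_wpM2r ?exprn_ge0 ?walk_rate_ge0 //.
by apply: sum_potential; apply: leq_trans hl; rewrite leq_addr.
Qed.

Lemma potential_nil i : potential [::] i = 1.
Proof.
have s0 Q : single Q [::] = 0%N by rewrite /single big1.
rewrite /potential s0 expr0 mul1r /Omega /moment_weight big1 // mulr1.
by rewrite /excess big1 // => u _; rewrite /deg s0 sub0n.
Qed.

Lemma closed_walk_sum_le n : (n <= l)%N ->
  `|\sum_i walk_sum mom n [::] i i| <= N%:R * walk_rate ^+ n.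
Proof.
move=> nl; apply: le_trans (ler_norm_sum _ _ _) _.
apply: (@le_trans _ _ (\sum_(i < N) walk_rate ^+ n)).
  by apply: ler_sum => i _; have := @walk_sum_le n [::] i i nl; rewrite potential_nil mul1r.
by rewrite sumr_const card_ord mulr_natl.
Qed.

(** Number of paths of [n] steps [+1] or [-1] from height [s] to height [0] that
    never go below [0]. *)
Fixpoint ballot n s : nat :=
  if n is n'.+1 then (ballot n' s.+1 + (if s is s'.+1 then ballot n' s' else 0))%N
  else (s == 0)%N.

Lemma ballot_le n s : (ballot n s <= 2 ^ n)%N.
Proof.
elim: n s => [|n IHn] s /=; first by case: s.
rewrite expnS mul2n -addnn leq_add //; case: s => // s; exact: IHn.
Qed.

Fixpoint stack_edges i st : seq edge :=
  if st is j :: st' then ed i j :: stack_edges j st' else [::].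

(** The leading walks: every step goes to a new vertex or back along the last edge
    that is still open.  The open edges form the path from the current vertex
    through the stack to the root [i0]. *)
Inductive tree_like i0 : seq edge -> V -> seq V -> Prop :=
| TreeStart : tree_like i0 [::] i0 [::]
| TreePush h i st j : tree_like i0 h i st -> is_new h i j ->
    tree_like i0 (ed i j :: h) j (i :: st)
| TreePop h i j st : tree_like i0 h i (j :: st) -> tree_like i0 (ed i j :: h) j st.

Lemma stack_edges_sub u i st e : e \in stack_edges i st -> touches u e -> u \in i :: st.
Proof.
elim: st i => // j st IH i /=; rewrite inE => /orP[/eqP ->|est tu].
  by rewrite touches_ed !inE => /orP[->//|->]; rewrite orbT.
by rewrite inE (IH j) ?orbT.
Qed.

Lemma stack_edges_touch u i j st : u \in i :: j :: st -> has (touches u) (stack_edges i (j :: st)).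
Proof.
elim: st i j => [|k st IH] i j /=.
  by rewrite !inE touches_ed orbF.
rewrite inE touches_ed => /orP[->//|/IH /= ->]; by rewrite orbT.
Qed.

Lemma tree_like_inv i0 h i st : tree_like i0 h i st ->
  [/\ last i st = i0, uniq (i :: st), uniq (stack_edges i st),
    forall e, (count_mem e h == 1%N) = (e \in stack_edges i st) &
    forall e, (count_mem e h <= 2)%N].
Proof.
elim=> {h i st} [|h i st j _ [la us ue c1 c2] nj|h i j st _ [la us ue c1 c2]].
- by split.
- have c0 := is_new_count nj.
  have ns : ed j i \notin stack_edges i st by rewrite -c1 edC c0.
  split => //.
  + rewrite cons_uniq us andbT inE negb_or; case/andP: nj => -> /hasPn nj /=.
    apply/negP => jst; case: st => // k st in la us ue c1 ns jst *.
    have : j \in i :: k :: st by rewrite inE jst orbT.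
    case/stack_edges_touch/hasP => e est te.
    by have := nj e; rewrite te -has_pred1 has_count lt0n => h'; 
       move: est; rewrite -c1 => /eqP ce; move: h'; rewrite ce => /(_ isT).
  + by rewrite /= ns.
  + move=> e; rewrite -[stack_edges j _]/(ed j i :: stack_edges i st) inE [ed j i]edC.
    case: (eqVneq e (ed i j)) => [->|ne]; first by rewrite count_mem_cons eqxx c0.
    by rewrite count_mem_other // c1.
  + move=> e; rewrite count_mem_cons; case: (eqVneq (ed i j) e) => [<-|_]; first by rewrite c0.
    by rewrite add0n.
- have [ns ue'] : ed i j \notin stack_edges j st /\ uniq (stack_edges j st).
    by move: ue => /= /andP[].
  have c1' : count_mem (ed i j) h = 1%N by apply/eqP; rewrite c1 /= inE eqxx.
  split => //.
  + by move: us => /= /andP[].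
  + move=> e; case: (eqVneq e (ed i j)) => [->|ne].
      by rewrite count_mem_cons eqxx c1' (negbTE ns).
    by rewrite count_mem_other // c1 /= inE (negbTE ne).
  + move=> e; case: (eqVneq e (ed i j)) => [->|ne]; first by rewrite count_mem_cons eqxx c1'.
    by rewrite count_mem_other.
Qed.

(** A tree-like walk can only go back to its parent. *)
Lemma tree_like_closing i0 h i st k : tree_like i0 h i st ->
  (count_mem (ed i k) h == 1%N) = (ohead st == Some k).
Proof.
move=> /tree_like_inv[_ us _ c1 _]; rewrite c1; case: st us {c1} => //= j st us.
rewrite inE (inj_eq (@ed_inj i)) eq_sym /= -[Some j == Some k]/(j == k).
rewrite (_ : ed i k \in _ = false) ?orbF //.
apply/negP => ek; have ij : i \in j :: st.
  by apply: stack_edges_sub ek _; rewrite touches_ed eqxx.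
by move: us; rewrite ij.
Qed.

Lemma tree_like_single i0 h i st : tree_like i0 h i st -> single predT h = size st.
Proof.
move=> /tree_like_inv[_ _ ue c1 _].
have -> : size st = size (stack_edges i st) by elim: (st) i {ue c1} => //= j s IH i; rewrite (IH j).
rewrite -sum_count_mem; apply: eq_bigr => e _.
by rewrite andbT c1 count_uniq_mem.
Qed.

Lemma tree_like_Omega i0 h i st : tree_like i0 h i st -> Omega h = sg ^+ size h.
Proof.
move=> /tree_like_inv[_ _ _ _ c2].
rewrite -sum_count_mem -prodrXr; apply: eq_bigr => e _.
by have := c2 e; case: (count_mem e h) => [|[|[|]]] //= _; rewrite expr0 ?mulr1.
Qed.

Hypothesis mom2E : mom 2 = sg ^+ 2.

Lemma tree_like_moment i0 h i : tree_like i0 h i [::] -> moment_weight mom h = sg ^+ size h.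
Proof.
move=> /tree_like_inv[_ _ _ c1 c2].
rewrite -sum_count_mem -prodrXr; apply: eq_bigr => e _.
by have := c2 e; have := c1 e; case: (count_mem e h) => [|[|[|]]] //= _ _; rewrite expr0.
Qed.

(** The new and the closing steps reproduce the recursion of [ballot].  The error
    collects the exceptional steps, bounded by [walk_sum_le], and the old vertices
    missing from the [N] choices of a new one; each has relative size
    [exceptional_cost / walk_rate]. *)
Lemma tree_like_approx n i0 h i st : tree_like i0 h i st -> (size h + n <= l)%N ->
  `|walk_sum mom n h i i0 -
    sg ^+ (size h + n) * r ^+ n * r^-1 ^+ size st * (ballot n (size st))%:R|
  <= potential h i * (2 * exceptional_cost * n%:R * walk_rate ^+ n.-1).
Proof.
have rn0 : r != 0 by rewrite gt_eqF.
elim: n h i st => [|n IHn] h i st th hl.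
  rewrite mulr0 mul0r mulr0 addn0 expr0 mulr1 /= normr_le0 subr_eq0.
  have [la us _ _ _] := tree_like_inv th.
  case: st th la us => [|j st] th la us.
    by rewrite -la /= eqxx mul1r expr0 !mulr1 (tree_like_moment th).
  rewrite /= mulr0; case: (eqVneq i i0) => [ii|_]; last by rewrite mul0r eqxx.
  by move: us; rewrite {1}ii -la /= mem_last.
set P := potential h i; set En := 2 * exceptional_cost * n%:R * walk_rate ^+ n.-1.
have P0 : 0 <= P := potential_ge0 h i.
have En0 : 0 <= En by rewrite !mulr_ge0 ?exceptional_cost_ge0 ?exprn_ge0 ?walk_rate_ge0.
have hl' : (size h <= l)%N by apply: leq_trans hl; rewrite leq_addr.
have hl2 k : (size (ed i k :: h) + n <= l)%N by rewrite /= addSnnS.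
pose M s := sg ^+ ((size h).+1 + n) * r ^+ n * r^-1 ^+ s * (ballot n s)%:R.
pose W k := walk_sum mom n (ed i k :: h) k i0.
have M0 s : 0 <= M s by rewrite !mulr_ge0 ?exprn_ge0 // ltW.
have eT : sg ^+ (size h + n.+1) * r ^+ n.+1 * r^-1 ^+ size st * (ballot n.+1 (size st))%:R =
    N%:R * M (size st).+1 + (if st is _ :: st' then M (size st') else 0).
  rewrite /M -rN addSnnS /= natrD mulrDr; congr (_ + _).
    by rewrite (exprS r^-1) exprS expr2; field; rewrite rn0.
  case: (st) => [|k st'] /=; first by rewrite mulr0.
  by rewrite (exprS r^-1) (exprS r); field; rewrite rn0.
have eW : walk_sum mom n.+1 h i i0 = \sum_k W k by [].
rewrite eT eW.
rewrite (bigID (is_new h i)) (bigID [pred j | count_mem (ed i j) h == 1%N] [pred j | ~~ is_new h i j]) /=.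
set Sn := \sum_(k | is_new h i k) W k; set Sc := \sum_(k | _ && _) W k; set Se := \sum_(k | _ && _) W k.
have bn : `|Sn - N%:R * M (size st).+1| <= P * (sg * r) * En + P * exceptional_cost * walk_rate ^+ n.
  have -> : Sn - N%:R * M (size st).+1 = \sum_(k | is_new h i k) (W k - M (size st).+1)
      - \sum_(k | ~~ is_new h i k) M (size st).+1.
    have -> : N%:R * M (size st).+1 = \sum_(k : V) M (size st).+1.
      by rewrite sumr_const card_ord mulr_natl.
    rewrite sumrB -/Sn (bigID (is_new h i) xpredT) /=; ring.
  apply: le_trans (ler_normB _ _) _; apply: lerD.
    apply: le_trans (ler_norm_sum _ _ _) _.
    apply: le_trans (ler_wpM2r En0 (sum_new h i)); rewrite mulr_suml; apply: ler_sum => k nk.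
    exact: (IHn (ed i k :: h) k (i :: st) (TreePush th nk) (hl2 k)).
  rewrite ger0_norm ?sumr_ge0 // sumr_const -[leLHS]mulr_natl -mulrA /exceptional_cost.
  have lem1 : M (size st).+1 <= P * (K * walk_rate ^+ n).
    have -> : M (size st).+1 = (r^-1 ^+ size st * sg ^+ size h) *
        ((sg * r^-1) * ((sg * r) ^+ n * (ballot n (size st).+1)%:R)).
      by rewrite /M exprMn addSnnS exprD !exprS; ring.
    have t0 : 0 <= (sg * r) ^+ n by rewrite exprn_ge0 // mulr_ge0 // ltW.
    apply: ler_pM.
    - by rewrite mulr_ge0 ?exprn_ge0.
    - by rewrite !mulr_ge0.
    - rewrite /P /potential (tree_like_single th) (tree_like_Omega th) ler_peMl //.
        by rewrite mulr_ge0 ?exprn_ge0.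
      by rewrite exprn_ege1.
    - apply: ler_pM; rewrite ?mulr_ge0 //.
        by apply: le_trans sgK; rewrite ler_piMr.
      apply: (@le_trans _ _ ((2 * (sg * r)) ^+ n)).
        rewrite [leRHS]exprMn [leLHS]mulrC ler_wpM2r // -natrX ler_nat; exact: ballot_le.
      rewrite lerXn2r ?nnegrE ?walk_rate_ge0 //; last by rewrite lerDl exceptional_cost_ge0.
      by rewrite !mulr_ge0 // ltW.
  have c2 : (#|[pred k | ~~ is_new h i k]|%:R : R) <= (2 * l).+1%:R.
    rewrite ler_nat; apply: (@leq_trans (2 * size h).+1); last by rewrite ltnS leq_mul.
    apply: leq_trans (card_not_new h i); apply: subset_leq_card; apply/fintype.subsetP => j.
    by rewrite !inE.
  apply: le_trans (ler_pM _ _ c2 lem1) _ => //.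
  rewrite mulrCA ler_wpM2l // -mulrA ler_wpM2l // ler_wpM2r ?exprn_ge0 ?walk_rate_ge0 //.
  by rewrite ler_peMl // exprn_ege1.
have bc : `|Sc - (if st is _ :: st' then M (size st') else 0)| <= P * (sg * r) * En.
  have eSc : Sc = \sum_(k | ohead st == Some k) W k.
    apply: eq_bigl => k; rewrite -(tree_like_closing k th) andbC.
    case: eqP => //= c1; apply/negP => /is_new_count; by rewrite c1.
  case: st th eSc {eT bn} => [|j st] th eSc.
    rewrite subr0 eSc big_pred0 // normr0; apply: mulr_ge0 => //; apply: mulr_ge0 => //.
    by apply: mulr_ge0 => //; exact: ltW.
  rewrite eSc (big_pred1 j); last by move=> k; rewrite /= eq_sym.
  apply: le_trans (IHn _ j st (TreePop th) (hl2 j)) _.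
  apply: le_trans (ler_wpM2r En0 (sum_closing i hl')); apply: ler_wpM2r => //.
  rewrite (bigD1 j) /=; last by rewrite (tree_like_closing j th) /=.
  by rewrite lerDl sumr_ge0 // => k _; exact: potential_ge0.
have be : `|Se| <= P * exceptional_cost * walk_rate ^+ n.
  apply: le_trans (ler_norm_sum _ _ _) _.
  have := ler_wpM2r (exprn_ge0 n walk_rate_ge0) (sum_exceptional i hl').
  apply: le_trans; rewrite mulr_suml; apply: ler_sum => k _.
  exact: walk_sum_le.
have -> : forall a b c d e : R, a + (b + c) - (d + e) = (a - d) + (b - e) + c by move=> *; ring.
apply: le_trans (ler_normD _ _) _; apply: (le_trans (lerD (ler_normD _ _) (lexx _))).
apply: (le_trans (lerD (lerD bn bc) be)).
have -> : P * (sg * r) * En + P * exceptional_cost * walk_rate ^+ n + P * (sg * r) * En + P * exceptional_cost * walk_rate ^+ n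
  = P * (2 * (sg * r) * En + 2 * exceptional_cost * walk_rate ^+ n) by ring.
apply: ler_wpM2l => //; apply: (@le_trans _ _ (walk_rate * En + 2 * exceptional_cost * walk_rate ^+ n)).
  by rewrite lerD2r ler_wpM2r // lerDl exceptional_cost_ge0.
rewrite /En /= -natr1 le_eqVlt; apply/orP; left; apply/eqP.
case: (n) => [|n'] /=; first by rewrite expr0; ring.
by rewrite exprS; ring.
Qed.

Lemma closed_walk_sum_approx n : (n <= l)%N ->
  `|\sum_i walk_sum mom n [::] i i - N%:R * (sg ^+ n * r ^+ n * (ballot n 0)%:R)|
  <= N%:R * (2 * exceptional_cost * n%:R * walk_rate ^+ n.-1).
Proof.
move=> nl; have -> (x : R) : N%:R * x = \sum_(i < N) x.
  by rewrite sumr_const card_ord mulr_natl.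
rewrite -sumrB; apply: le_trans (ler_norm_sum _ _ _) _.
have -> (x : R) : N%:R * x = \sum_(i < N) x.
  by rewrite sumr_const card_ord mulr_natl.
apply: ler_sum => i _.
by have := tree_like_approx (TreeStart i) nl; rewrite potential_nil mul1r expr0 mulr1.
Qed.
End Walks.

(** * Closed walks that share an edge *)

Section Covariance.
Variable N : nat.
Local Notation V := 'I_N.
Local Notation edge := (V * V)%type.
Implicit Types (c s : seq V) (x y z u : V) (e : edge).

Definition cycle_edges c : seq edge := if c is x :: s then pairmap (@ed N) x (rcons s x) else [::].

Lemma size_cycle_edges c : size (cycle_edges c) = size c.
Proof. by case: c => //= x s; rewrite size_pairmap size_rcons. Qed.

Lemma pairmap_rcons x s z :
  pairmap (@ed N) x (rcons s z) = rcons (pairmap (@ed N) x s) (ed (last x s) z).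
Proof. by elim: s x => //= y s IH x; rewrite IH. Qed.

Lemma cycle_edges_rot1 c : cycle_edges (rot 1 c) = rot 1 (cycle_edges c).
Proof.
case: c => // x [|y s] //.
rewrite rot1_cons -[cycle_edges (x :: _)]/(ed x y :: pairmap (@ed N) y (rcons s x)) rot1_cons.
by rewrite -[LHS]/(pairmap (@ed N) y (rcons (rcons s x) y)) pairmap_rcons last_rcons.
Qed.

Lemma cycle_edges_rot n c : cycle_edges (rot n c) = rot n (cycle_edges c).
Proof.
elim: n => [|n IH]; first by rewrite !rot0.
case: (ltnP n (size c)) => nc; last by rewrite !rot_oversize ?size_cycle_edges // ltnW.
by rewrite -[n.+1]add1n !rotD ?size_cycle_edges // -IH cycle_edges_rot1.
Qed.

Lemma pairmap_ed_sub x s e u : e \in pairmap (@ed N) x s -> touches u e -> u \in x :: s.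
Proof.
elim: s x => // y s IH x /=; rewrite inE => /orP[/eqP ->|es tu].
  by rewrite touches_ed !inE => /orP[->//|->]; rewrite orbT.
by rewrite inE (IH y) ?orbT.
Qed.

Lemma cycle_edges_sub c e u : e \in cycle_edges c -> touches u e -> u \in c.
Proof.
case: c => // x s es /(pairmap_ed_sub es).
by rewrite !(inE, mem_rcons) orbA orbb.
Qed.

Definition inside (A : {set V}) e := (e.1 \in A) && (e.2 \in A).

(** The edge by which a vertex is first entered determines that vertex. *)
Lemma new_vertices_le (A : {set V}) x s : x \in A ->
  (#|[set v in x :: s] :\: A| <= #|[set e in pairmap (@ed N) x s | ~~ inside A e]|)%N.
Proof.
move=> xA; elim/last_ind: s => [|s z IH].
  by rewrite (_ : _ :\: _ = finset.set0) ?cards0 //; apply/finset.setP => v; rewrite !inE; case: (eqVneq v x) => [->|]; rewrite ?xA ?andbF.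
rewrite pairmap_rcons; set e0 := ed _ z.
have sub : [set e in pairmap (@ed N) x s | ~~ inside A e]%SET \subset
   [set e in rcons (pairmap (@ed N) x s) e0 | ~~ inside A e]%SET.
  by apply/fintype.subsetP => e; rewrite !inE mem_rcons inE => /andP[-> ->]; rewrite orbT.
case: (boolP ((z \in A) || (z \in x :: s))) => [zz|].
  apply: leq_trans (subset_leq_card sub); apply: leq_trans IH.
  apply: subset_leq_card; apply/fintype.subsetP => v; rewrite !inE mem_rcons inE.
  case/andP=> vA; rewrite vA /= => /or3P[->//|/eqP vz|->]; last by rewrite orbT.
  by move: zz; rewrite -vz (negbTE vA) /= inE.
rewrite negb_or => /andP[zA zs].
have -> : ([set v in x :: rcons s z] :\: A = z |: ([set v in x :: s] :\: A))%SET.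
  apply/finset.setP => v; rewrite !inE mem_rcons inE.
  by case: (eqVneq v z) => [->|]; rewrite ?zA ?orbT //= orbC.
have e0N : e0 \notin pairmap (@ed N) x s.
  by apply: contra zs => /pairmap_ed_sub; apply; rewrite touches_ed eqxx orbT.
have e0A : ~~ inside A e0.
  by apply: contra zA; rewrite /inside /e0 /ed; case: ifP => _ /andP[].
have -> : ([set e in rcons (pairmap (@ed N) x s) e0 | ~~ inside A e] =
   e0 |: [set e in pairmap (@ed N) x s | ~~ inside A e])%SET.
  apply/finset.setP => e; rewrite !inE mem_rcons inE.
  by case: (eqVneq e e0) => [->|]; rewrite ?e0A.
by rewrite !cardsU1 !inE zA (negbTE e0N) -in_cons (negbTE zs) /= leq_add2l.
Qed.

Definition vset c := [set v in c]%SET.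
Definition eset c := [set e in cycle_edges c]%SET.

Lemma vset_rot n c : vset (rot n c) = vset c.
Proof. by apply/finset.setP => v; rewrite !inE mem_rot. Qed.

Lemma eset_rot n c : eset (rot n c) = eset c.
Proof. by apply/finset.setP => v; rewrite !inE cycle_edges_rot mem_rot. Qed.

Lemma cycle_edges_cons x s :
  cycle_edges (x :: s) = rcons (pairmap (@ed N) x s) (ed (last x s) x).
Proof. by rewrite /= pairmap_rcons. Qed.

Lemma vset_cons_le x s : (#|vset (x :: s)| <= #|[set e in pairmap (@ed N) x s]%SET|.+1)%N.
Proof.
rewrite (cardsD1 x) !inE eqxx add1n ltnS.
apply: (leq_trans (new_vertices_le s (set11 x))).
by apply: subset_leq_card; apply/fintype.subsetP => e; rewrite !inE => /andP[].
Qed.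

Lemma card_vset_le c : (#|vset c| <= #|eset c|.+1)%N.
Proof.
case: c => [|x s]; first by rewrite (_ : vset _ = finset.set0) ?cards0 //; apply/finset.setP => v; rewrite !inE.
apply: (leq_trans (vset_cons_le x s)); rewrite ltnS; apply: subset_leq_card.
apply/fintype.subsetP => e; rewrite !inE => es.
by rewrite cycle_edges_cons mem_rcons inE es orbT.
Qed.

(** Rotate the cycle so that the edge crossed once comes last: the remaining path
    still visits all vertices, and it does not use that edge. *)
Lemma card_vset_le_single c e : count_mem e (cycle_edges c) = 1%N ->
  (#|vset c| <= #|eset c|)%N.
Proof.
move=> c1; have ec : e \in cycle_edges c by rewrite -has_pred1 has_count c1.
set k := index e (cycle_edges c).
have kc : (k < size (cycle_edges c))%N by rewrite index_mem.
rewrite -(vset_rot k.+1) -(eset_rot k.+1); set c' := rot k.+1 c.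
have ec' : exists h, cycle_edges c' = rcons h e /\ e \notin h.
  exists (drop k.+1 (cycle_edges c) ++ take k (cycle_edges c)).
  have eq1 : cycle_edges c' = rcons (drop k.+1 (cycle_edges c) ++ take k (cycle_edges c)) e.
    by rewrite /c' cycle_edges_rot /rot (take_nth e kc) nth_index // rcons_cat.
  split => //; have : count_mem e (cycle_edges c') = 1%N.
    rewrite /c' cycle_edges_rot -c1; apply/permP; by rewrite perm_rot.
  rewrite eq1 -cats1 count_cat /= eqxx addn0 addn1 => -[] h0.
  by apply/count_memPn.
move: ec'; case: c' => [|x s] [h []]; first by case: h.
rewrite cycle_edges_cons => /rcons_inj[<- <-] nh.
apply: (leq_trans (vset_cons_le x s)).
rewrite [in X in (_ <= X)%N](cardsD1 (ed (last x s) x)) !inE cycle_edges_cons mem_rcons inE eqxx add1n ltnS.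
apply: subset_leq_card; apply/fintype.subsetP => e'; rewrite !inE cycle_edges_cons mem_rcons inE => es.
by rewrite es orbT andbT; apply: contraNneq nh => <-.
Qed.

Lemma card_vset_new_le c1 c2 u : u \in c1 -> u \in c2 ->
  (#|vset c2 :\: vset c1| <= #|eset c2 :\: eset c1|)%N.
Proof.
move=> u1 u2; have [k s ek] := rot_to u2.
rewrite -(vset_rot k c2) -(eset_rot k c2) ek.
apply: (@leq_trans #|[set e in pairmap (@ed N) u s | ~~ inside (vset c1) e]%SET|).
  by apply: new_vertices_le; rewrite inE.
apply: subset_leq_card; apply/fintype.subsetP => e; rewrite !inE cycle_edges_cons => /andP[es ni].
rewrite mem_rcons inE es orbT andbT; apply: contra ni => e1.
by rewrite /inside !inE !(cycle_edges_sub e1) // /touches eqxx ?orbT.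
Qed.

(** The [2 * p] steps cover at most [p] distinct edges, so a connected union has at
    most [p + 1] vertices.  With exactly [p] edges each is crossed twice; a shared
    edge is then crossed once by [c1], lies on a cycle, and one vertex is lost. *)
Lemma shared_edge_vertices_le c1 c2 p e : size c1 = p -> size c2 = p ->
  e \in cycle_edges c1 -> e \in cycle_edges c2 ->
  (forall f, count_mem f (cycle_edges c1 ++ cycle_edges c2) != 1%N) ->
  (#|vset c1 :|: vset c2| <= p)%N.
Proof.
move=> s1 s2 e1 e2 n1.
set h := cycle_edges c1 ++ cycle_edges c2 in n1.
have u1 : e.1 \in c1 by apply: (cycle_edges_sub e1); rewrite /touches eqxx.
have u2 : e.1 \in c2 by apply: (cycle_edges_sub e2); rewrite /touches eqxx.
have unionE (T : finType) (A B : {set T}) : #|A :|: B|%SET = (#|A| + #|B :\: A|)%N.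
  by rewrite -cardsUI (_ : A :&: (B :\: A) = finset.set0)%SET ?cards0 ?addn0;
    [congr #|pred_of_set _|; apply/finset.setP => x|apply/finset.setP => x]; rewrite !inE; case: (x \in A).
have vle := card_vset_new_le u1 u2.
have cE : (#|eset c1| + #|eset c2 :\: eset c1| = #|eset c1 :|: eset c2|)%N by rewrite unionE.
set E := (eset c1 :|: eset c2)%SET in cE.
have inE' f : (f \in E) = (f \in h) by rewrite !inE mem_cat.
have sumh : (\sum_(f in E) count_mem f h = 2 * p)%N.
  transitivity (\sum_f count_mem f h)%N.
    rewrite big_mkcond; apply: eq_bigr => f _; rewrite inE'.
    by case: ifPn => // /count_memPn ->.
  by rewrite sum_count_mem size_cat !size_cycle_edges s1 s2 addnn mul2n.
have ge2 f : f \in E -> (2 <= count_mem f h)%N.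
  rewrite inE' -has_pred1 has_count; have := n1 f; by case: (count_mem f h) => [|[|]].
have Ep : (#|E| <= p)%N.
  have : (\sum_(f in E) 2 <= \sum_(f in E) count_mem f h)%N by apply: leq_sum.
  by rewrite sumh sum_nat_const mulnC leq_pmul2l.
rewrite unionE; case: (ltngtP #|E| p) Ep => // [lt|eq] _.
  have := card_vset_le c1; lia.
suff c1e : count_mem e (cycle_edges c1) = 1%N.
  have := card_vset_le_single c1e; lia.
have eE : e \in E by rewrite inE' mem_cat e1.
have le2 : (count_mem e h <= 2)%N.
  have := sumh; rewrite (bigD1 e) //=.
  have : (\sum_(f in E | f != e) 2 <= \sum_(f in E | f != e) count_mem f h)%N.
    by apply: leq_sum => f /andP[/ge2].
  rewrite sum_nat_const (_ : #|_| = #|E|.-1); last first.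
    rewrite (cardsD1 e E) eE /=; apply: eq_card => f.
    by rewrite in_setD1 [LHS]unfold_in /= andbC.
  have : (0 < #|E|)%N by apply/card_gt0P; exists e.
  rewrite -eq; move: (count_mem e h) (\sum_(_ in _ | _) _)%N; lia.
move: le2; rewrite /h count_cat.
have : (0 < count_mem e (cycle_edges c1))%N by rewrite -has_count has_pred1.
have : (0 < count_mem e (cycle_edges c2))%N by rewrite -has_count has_pred1.
lia.
Qed.
End Covariance.

Section CovarianceSum.
Variables (R : realFieldType) (N : nat).
Local Notation V := 'I_N.
Local Notation edge := (V * V)%type.
Variables (mom : nat -> R) (K : R).
Hypotheses (mom0 : mom 0 = 1) (mom1 : mom 1 = 0) (K0 : 0 <= K)
  (momK : forall m, `|mom m| <= K ^+ m).
Local Notation mw := (moment_weight mom).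

Lemma moment_weight_norm_le (h : seq edge) : `|mw h| <= K ^+ size h.
Proof.
rewrite normr_prod -sum_count_mem -prodrXr; apply: ler_prod => e _.
by rewrite normr_ge0 momK.
Qed.

Lemma moment_weight_single (h : seq edge) e : count_mem e h = 1%N -> mw h = 0.
Proof. by move=> c1; rewrite /moment_weight (bigD1 e) //= c1 mom1 mul0r. Qed.

Lemma moment_weight_disjoint (h1 h2 : seq edge) : (forall e, e \in h1 -> e \notin h2) ->
  mw (h1 ++ h2) = mw h1 * mw h2.
Proof.
move=> dis; rewrite /moment_weight -big_split; apply: eq_bigr => e _ /=.
rewrite count_cat; case: (boolP (e \in h1)) => [/dis/count_memPn ->|/count_memPn ->].
  by rewrite addn0 mom0 mulr1.
by rewrite add0n mom0 mul1r.
Qed.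

(** Choose [p] labels, then the label of each of the [2 * p] positions. *)
Lemma card_few_vertices p : (0 < p)%N ->
  (#|[set c : p.-tuple V * p.-tuple V | (#|vset c.1 :|: vset c.2| <= p)%N]%SET|
    <= N ^ p * (p ^ p * p ^ p))%N.
Proof.
move=> p0; have -> : (N ^ p * (p ^ p * p ^ p) =
    #|{: p.-tuple V * (p.-tuple 'I_p * p.-tuple 'I_p)}|)%N.
  by rewrite !card_prod !card_tuple !card_ord.
pose F (w : p.-tuple V * (p.-tuple 'I_p * p.-tuple 'I_p)) :=
  ([tuple of map (tnth w.1) w.2.1], [tuple of map (tnth w.1) w.2.2]).
apply: (@leq_trans #|[set F w | w in [set: p.-tuple V * (p.-tuple 'I_p * p.-tuple 'I_p)]]%SET|); last first.
  by apply: leq_trans (leq_imset_card _ _) _; rewrite cardsT.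
apply: subset_leq_card; apply/fintype.subsetP => -[c1 c2]; rewrite inE /= => cp.
pose x0 := tnth c1 (Ordinal p0).
pose S := enum (vset c1 :|: vset c2)%SET.
have Sp : (size S <= p)%N by rewrite -cardE.
pose w : p.-tuple V := [tuple nth x0 S i | i < p].
pose f x : 'I_p := insubd (Ordinal p0) (index x S).
have wf x : x \in S -> tnth w (f x) = x.
  move=> xS; rewrite tnth_mktuple /f val_insubd.
  by rewrite (leq_trans _ Sp) ?index_mem // nth_index.
apply/imsetP; exists (w, ([tuple of map f c1], [tuple of map f c2])); first by rewrite inE.
rewrite /F /=; congr (_, _); apply: val_inj => /=; rewrite -map_comp map_id_in // => x xc /=;
  by rewrite wf // mem_enum !inE xc ?orbT.
Qed.

(** Walks without common edge are uncorrelated, and an edge of multiplicity one kills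
    both terms; the other pairs have at most [p] vertices. *)
Lemma covariance_sum_le p : (0 < p)%N ->
  `|\sum_(c1 : p.-tuple V) \sum_(c2 : p.-tuple V)
     (mw (cycle_edges c1 ++ cycle_edges c2) - mw (cycle_edges c1) * mw (cycle_edges c2))|
  <= N%:R ^+ p * (p%:R ^+ p * p%:R ^+ p) * (2 * K ^+ (p + p)).
Proof.
move=> p0; rewrite pair_big; apply: le_trans (ler_norm_sum _ _ _) _.
pose A := [set c : p.-tuple V * p.-tuple V | (#|vset c.1 :|: vset c.2| <= p)%N]%SET.
apply: (@le_trans _ _ (\sum_(c in A) (2 * K ^+ (p + p)))); last first.
  rewrite sumr_const -[leLHS]mulr_natl ler_wpM2r ?mulr_ge0 ?exprn_ge0 //.
  by rewrite -!natrX -!natrM ler_nat card_few_vertices.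
rewrite [leRHS]big_mkcond; apply: ler_sum => -[c1 c2] _ /=.
have sz (c : p.-tuple V) : size (cycle_edges c) = p by rewrite size_cycle_edges size_tuple.
case: (boolP (has (mem (cycle_edges c2)) (cycle_edges c1))) => [/hasP[e e1 e2]|nsh]; last first.
  rewrite moment_weight_disjoint ?subrr ?normr0; last first.
    by move=> e e1; apply: contra nsh => e2; apply/hasP; exists e.
  by case: ifP => // _; rewrite mulr_ge0 ?exprn_ge0.
case: (boolP [forall f, count_mem f (cycle_edges c1 ++ cycle_edges c2) != 1%N]) => [/forallP al|].
  have -> : (c1, c2) \in A.
    by rewrite inE /=; apply: (shared_edge_vertices_le _ _ e1 e2 al); rewrite size_tuple.
  apply: le_trans (ler_normB _ _) _; rewrite mulr_natl mulr2n; apply: lerD.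
    by apply: le_trans (moment_weight_norm_le _) _; rewrite size_cat !sz.
  rewrite normrM exprD ler_pM //.
    by apply: le_trans (moment_weight_norm_le _) _; rewrite !sz.
  by apply: le_trans (moment_weight_norm_le _) _; rewrite !sz.
rewrite negb_forall => /existsP[f]; rewrite negbK => /eqP cf.
rewrite (moment_weight_single cf) sub0r normrN.
have -> : mw (cycle_edges c1) * mw (cycle_edges c2) = 0.
  move: cf; rewrite count_cat => cf.
  have [h|h] : count_mem f (cycle_edges c1) = 1%N \/ count_mem f (cycle_edges c2) = 1%N by lia.
    by rewrite (moment_weight_single h) mul0r.
  by rewrite (moment_weight_single h) mulr0.
by rewrite normr0; case: ifP => // _; rewrite mulr_ge0 ?exprn_ge0.
Qed.
End CovarianceSum.

Section TraceExpansion.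
Variables (R : comPzRingType) (N : nat).
Local Notation V := 'I_N.
Implicit Types (W : 'M[R]_N).

Definition edge_prod W (h : seq (V * V)) := \prod_(e <- h) W e.1 e.2.

Lemma edge_prod_cons_ed W i j h : W^T = W -> edge_prod W (ed i j :: h) = W i j * edge_prod W h.
Proof.
move=> sW; rewrite /edge_prod big_cons /ed; case: ifP => //= _.
by congr (_ * _); rewrite -[in LHS]sW mxE.
Qed.

Lemma exprmxS_entry W n i j : (W ^+ n.+1) i j = \sum_k W i k * (W ^+ n) k j.
Proof. by rewrite exprS mxE. Qed.

Lemma sum_tuple_cons n (F : n.+1.-tuple V -> R) :
  \sum_t F t = \sum_i \sum_(s : n.-tuple V) F [tuple of i :: s].
Proof.
rewrite pair_big /= (reindex (fun p : V * n.-tuple V => [tuple of p.1 :: p.2])) //.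
exists (fun t => (thead t, [tuple of behead t])) => [[i s] _|t _] /=.
  by congr (_, _); apply: val_inj.
by rewrite -tuple_eta.
Qed.

Lemma exprmx_walks W n i j : W^T = W ->
  (W ^+ n.+1) i j = \sum_(s : n.-tuple V) edge_prod W (pairmap (@ed N) i (rcons s j)).
Proof.
move=> sW; elim: n i => [|n IH] i.
  rewrite expr1 (big_pred1 [tuple]) => [|t]; last by apply/esym/eqP; exact: tuple0.
  by rewrite /= edge_prod_cons_ed // /edge_prod big_nil mulr1.
rewrite exprmxS_entry sum_tuple_cons; apply: eq_bigr => k _.
rewrite IH mulr_sumr; apply: eq_bigr => s _.
by rewrite /= edge_prod_cons_ed.
Qed.

Lemma mxtrace_exprS W n : W^T = W ->
  \tr (W ^+ n.+1) = \sum_(c : n.+1.-tuple V) edge_prod W (cycle_edges c).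
Proof.
move=> sW; rewrite sum_tuple_cons; apply: eq_bigr => i _.
by rewrite exprmx_walks.
Qed.
End TraceExpansion.

(** * Growth of the ballot numbers *)

Lemma ballot_gt n s : (n < s)%N -> ballot n s = 0%N.
Proof.
elim: n s => [|n IH] [|s] //= ns.
by rewrite !IH //; lia.
Qed.

(** The reflection principle: [ballot n s] is ['C(n, a) - 'C(n, a - 1)]. *)
Lemma ballot_bin n s a : n = (s + 2 * a)%N ->
  (ballot n s + (if a is a'.+1 then 'C(n, a') else 0) = 'C(n, a))%N.
Proof.
elim: n s a => [|n IH] s a e; first by have [-> ->] : s = 0%N /\ a = 0%N by lia.
case: a e => [|a] e.
  have {e} -> : s = n.+1 by lia.
  by rewrite /= ballot_gt // add0n; have := IH n 0%N; rewrite !bin0 => ->; lia.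
have h1 := IH s.+1 a ltac:(lia).
have eS : ('C(n.+1, a) = 'C(n, a) + (if a is a'.+1 then 'C(n, a') else 0))%N.
  by case: (a) => [|a']; rewrite ?bin0 // binS.
case: s e h1 => [|s] e h1 /=.
  have : 'C(n, a.+1) = 'C(n, a).
    by rewrite -(@bin_sub n a); [congr 'C(_, _); lia|lia].
  by rewrite eS binS; lia.
have := IH s a.+1 ltac:(lia); rewrite eS binS; lia.
Qed.

Lemma ballot_catalan k : (k.+1 * ballot (2 * k) 0 = 'C(2 * k, k))%N.
Proof.
case: k => [|k]; first by [].
have := @ballot_bin (2 * k.+1) 0 k.+1 (esym (add0n _)).
have := mul_bin_left (2 * k.+1) k.
rewrite (_ : 2 * k.+1 - k = k.+2)%N; last by lia.
move: (ballot _ _) 'C(_, k) 'C(_, _) => x y z; nia.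
Qed.

Lemma bin_double_ge k : (4 ^ k <= (2 * k).+1 * 'C(2 * k, k))%N.
Proof.
elim: k => [|k IH] //.
have h1 := mul_bin_diag (2 * k.+1) k.
have h2 := mul_bin_diag (2 * k).+1 k.
have h3 : 'C((2 * k).+1, k) = 'C((2 * k).+1, k.+1).
  by rewrite -(@bin_sub _ k); [congr 'C(_, _); lia|lia].
rewrite (_ : (2 * k.+1).-1 = (2 * k).+1) in h1; last by lia.
rewrite /= in h2.
have : (k.+1 * 4 ^ k.+1 <= k.+1 * ((2 * k.+1).+1 * 'C(2 * k.+1, k.+1)))%N.
  have h4 : (2 * 4 ^ k <= k.+1 * 'C(2 * k.+1, k.+1))%N.
    rewrite -h1 h3 mulnS mulnDl -mulnA; move: h2 IH.
    move: 'C((2 * k).+1, k.+1) 'C(2 * k, k) (4 ^ k)%N => x y z; lia.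
  rewrite expnS [X in (_ <= X)%N]mulnCA; apply: leq_trans (leq_mul (leqnn (2 * k.+1).+1) h4).
  by rewrite mulnA [X in (_ <= X)%N]mulnA leq_mul2r; apply/orP; right; lia.
by rewrite leq_pmul2l.
Qed.

Lemma ballot_growth k : (4 ^ k <= (2 * k).+1 * k.+1 * ballot (2 * k) 0)%N.
Proof. by rewrite -mulnA ballot_catalan bin_double_ge. Qed.

(** * Expectations of bounded functions of independent variables *)

Section BoundedExpectation.
Context d (T : measurableType d) (R : realType) (P : probability T R).
Implicit Types (f g : T -> R).

Definition bounded_mfun f := measurable_fun setT f /\ exists C, forall w, `|f w| <= C.
Definition expect f : R := \int[P]_w f w.

Lemma bounded_mfun_integrable f : bounded_mfun f -> P.-integrable setT (EFin \o f).
Proof.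
case=> mf [C fC]; apply: measurable_bounded_integrable => //.
  by have h : (P setT < +oo)%E by rewrite probability_setT ltry.
exists C; split; rewrite ?num_real // => x Cx w _ /=.
by rewrite (le_trans (fC w)) // ltW.
Qed.

Lemma bounded_mfun_cst c : bounded_mfun (fun=> c).
Proof. by split; [exact: measurable_cst|exists `|c|]. Qed.

Lemma bounded_mfunD f g : bounded_mfun f -> bounded_mfun g -> bounded_mfun (fun w => f w + g w).
Proof.
move=> [mf [C fC]] [mg [D gD]]; split; first exact: measurable_funD.
by exists (C + D) => w; rewrite (le_trans (ler_normD _ _)) // lerD.
Qed.

Lemma bounded_mfunM f g : bounded_mfun f -> bounded_mfun g -> bounded_mfun (fun w => f w * g w).
Proof.
move=> [mf [C fC]] [mg [D gD]]; split; first exact: measurable_funM.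
by exists (C * D) => w; rewrite normrM ler_pM.
Qed.

Lemma bounded_mfunB f g : bounded_mfun f -> bounded_mfun g -> bounded_mfun (fun w => f w - g w).
Proof.
move=> [mf [C fC]] [mg [D gD]]; split; first exact: measurable_funB.
by exists (C + D) => w; rewrite (le_trans (ler_normB _ _)) // lerD.
Qed.

Lemma bounded_mfunX f n : bounded_mfun f -> bounded_mfun (fun w => f w ^+ n).
Proof.
move=> bf; elim: n => [|n IH]; first exact: bounded_mfun_cst.
by under eq_fun do rewrite exprS; apply: bounded_mfunM.
Qed.

Lemma bounded_mfun_sum (I : Type) (s : seq I) (Q : pred I) (F : I -> T -> R) :
  (forall i, Q i -> bounded_mfun (F i)) -> bounded_mfun (fun w => \sum_(i <- s | Q i) F i w).
Proof.
move=> bF; elim: s => [|i s IH].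
  by under eq_fun do rewrite big_nil; exact: bounded_mfun_cst.
have [Qi|Qi] := boolP (Q i); last by under eq_fun do rewrite big_cons (negbTE Qi).
by under eq_fun do rewrite big_cons Qi; apply: bounded_mfunD => //; exact: bF.
Qed.

Lemma bounded_mfun_prod (I : Type) (s : seq I) (Q : pred I) (F : I -> T -> R) :
  (forall i, Q i -> bounded_mfun (F i)) -> bounded_mfun (fun w => \prod_(i <- s | Q i) F i w).
Proof.
move=> bF; elim: s => [|i s IH].
  by under eq_fun do rewrite big_nil; exact: bounded_mfun_cst.
have [Qi|Qi] := boolP (Q i); last by under eq_fun do rewrite big_cons (negbTE Qi).
by under eq_fun do rewrite big_cons Qi; apply: bounded_mfunM => //; exact: bF.
Qed.

Lemma expect_cst c : expect (fun=> c) = c.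
Proof. by rewrite /expect Rintegral_cst // (_ : fine _ = 1) ?mulr1 //; exact: (congr1 fine (@probability_setT _ _ _ P)). Qed.

Lemma expectD f g : bounded_mfun f -> bounded_mfun g ->
  expect (fun w => f w + g w) = expect f + expect g.
Proof. by move=> bf bg; rewrite /expect RintegralD //; exact: bounded_mfun_integrable. Qed.

Lemma expectB f g : bounded_mfun f -> bounded_mfun g ->
  expect (fun w => f w - g w) = expect f - expect g.
Proof. by move=> bf bg; rewrite /expect RintegralB //; exact: bounded_mfun_integrable. Qed.

Lemma expectZ c f : bounded_mfun f -> expect (fun w => c * f w) = c * expect f.
Proof. by move=> bf; rewrite /expect RintegralZl //; exact: bounded_mfun_integrable. Qed.

Lemma expect_sum (I : Type) (s : seq I) (Q : pred I) (F : I -> T -> R) :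
  (forall i, Q i -> bounded_mfun (F i)) ->
  expect (fun w => \sum_(i <- s | Q i) F i w) = \sum_(i <- s | Q i) expect (F i).
Proof.
move=> bF; elim: s => [|i s IH].
  rewrite big_nil -[RHS](expect_cst 0); congr expect.
  by apply/funext => w; rewrite big_nil.
rewrite big_cons; case: ifPn => Qi.
  rewrite -IH -expectD; [|exact: bF|exact: bounded_mfun_sum]; congr expect.
  by apply/funext => w; rewrite big_cons Qi.
by rewrite -IH; congr expect; apply/funext => w; rewrite big_cons (negbTE Qi).
Qed.

Lemma le_expect f g : bounded_mfun f -> bounded_mfun g -> (forall w, f w <= g w) ->
  expect f <= expect g.
Proof.
by move=> bf bg fg; apply: le_Rintegral => //; exact: bounded_mfun_integrable.
Qed.

Lemma expect_ge0 f : (forall w, 0 <= f w) -> 0 <= expect f.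
Proof. by move=> f0; apply: Rintegral_ge0. Qed.

Lemma le_norm_expect f g : bounded_mfun f -> bounded_mfun g ->
  (forall w, `|f w| <= g w) -> `|expect f| <= expect g.
Proof.
move=> bf bg fg; rewrite ler_norml -[- expect g]mulN1r -expectZ //.
have bN : bounded_mfun (fun w => -1 * g w) by apply: bounded_mfunM => //; exact: bounded_mfun_cst.
by apply/andP; split; apply: le_expect => // w; have := fg w; rewrite ler_norml ?mulN1r => /andP[].
Qed.

Lemma expect_norm_le f c : bounded_mfun f -> (forall w, `|f w| <= c) -> `|expect f| <= c.
Proof.
move=> bf fc; rewrite -[leRHS]expect_cst; apply: le_norm_expect => //.
exact: bounded_mfun_cst.
Qed.

Lemma bounded_mfun_indic (A : set T) : measurable A -> bounded_mfun (\1_A : T -> R).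
Proof.
move=> mA; split; first exact: measurable_indic.
by exists 1 => w; rewrite indicE; case: (w \in A); rewrite ?normr1 ?normr0.
Qed.

Lemma expect_indic (A : set T) : measurable A -> (expect \1_A)%:E = P A.
Proof.
move=> mA; rewrite /expect /Rintegral integral_indic // setIT fineK //.
exact: fin_num_measure.
Qed.

Lemma expect_markov f a : bounded_mfun f -> (forall w, 0 <= f w) -> 0 < a ->
  (P [set w | (a <= f w)%R] <= (expect f / a)%:E)%E.
Proof.
move=> bf f0 a0; have mA : measurable [set w | (a <= f w)%R].
  rewrite (_ : [set _ | _] = f @^-1` `[a, +oo[%classic); last first.
    by apply/seteqP; split => w /=; rewrite in_itv /= andbT.
  by rewrite -[_ @^-1` _]setTI; apply: (proj1 bf) => //; exact: measurable_itv.
rewrite -expect_indic // lee_fin ler_pdivlMr // mulrC -expectZ; last exact: bounded_mfun_indic.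
apply: le_expect => // [|w].
  by apply: bounded_mfunM; [exact: bounded_mfun_cst|exact: bounded_mfun_indic].
rewrite indicE; case: (boolP (_ \in _)) => [|_]; last by rewrite mulr0.
by rewrite inE /= mulr1.
Qed.
End BoundedExpectation.

Section IndependentProducts.
Context d (T : measurableType d) (R : realType) (P : probability T R).
Local Notation Ex := (expect P).

Lemma bounded_mfun_comp d' (T' : measurableType d') (Y : T -> T') (f : T' -> R) :
  measurable_fun setT Y -> bounded_mfun f -> bounded_mfun (fun w => f (Y w)).
Proof.
move=> mY [mf [C fC]]; split; last by exists C => w.
exact: (measurableT_comp mf mY).
Qed.

(** Round [f] down to a multiple of [eps]. *)
Lemma simple_approximation (f : R -> R) (eps : R) : 0 < eps -> bounded_mfun f ->
  exists (n : nat) (a : 'I_n -> R) (B : 'I_n -> set R),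
    (forall j, measurable (B j)) /\
    forall x, `|f x - \sum_(j < n) a j * \1_(B j) x| <= eps.
Proof.
move=> e0 [mf [C fC]].
have C0 : 0 <= C by apply: le_trans (fC 0); exact: normr_ge0.
pose q x := (f x + C) / eps.
have q0 x : 0 <= q x.
  by rewrite divr_ge0 ?(ltW e0) //; have := fC x; rewrite ler_norml; lra.
pose n := (Num.truncn (2 * C / eps)).+1.
have qn x : (Num.truncn (q x) < n)%N.
  rewrite ltnS; apply: le_truncn; rewrite ler_pM2r ?invr_gt0 //.
  by have := fC x; rewrite ler_norml; lra.
have mq : measurable_fun setT q.
  by apply: measurable_funM => //; apply: measurable_funD.
exists n, (fun j => j%:R * eps - C), (fun j => q @^-1` [set` `[j%:R, j.+1%:R[ ]); split => [j|x].
  by rewrite -[_ @^-1` _]setTI; apply: mq => //; exact: measurable_itv.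
rewrite (bigD1 (Ordinal (qn x))) //= big1 ?addr0 => [|j jx].
  rewrite indicE mem_set /=; last first.
    by rewrite in_itv /= truncn_le q0 truncnS_gt.
  rewrite mulr1; have h1 := truncn_le (q x); have h2 := truncnS_gt (q x).
  rewrite q0 in h1; move: h1 h2; rewrite -natr1; set t := (Num.truncn _)%:R.
  rewrite /q ler_pdivlMr // ltr_pdivrMr // => h1 h2.
  rewrite ler_norml; apply/andP; split; nra.
rewrite indicE memNset ?mulr0 //= in_itv /= => h; case/negP: jx; apply/eqP/val_inj => /=.
by apply/esym/eqP; rewrite truncn_eq.
Qed.

(** Both sides are linear in [f] and stable under uniform limits. *)
Lemma expect_mul_comp_ext (G : T -> R) (Y : {RV P >-> R}) c (f : R -> R) :
  bounded_mfun G ->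
  (forall B, measurable B -> Ex (fun w => G w * \1_B (Y w)) = c * Ex (fun w => \1_B (Y w))) ->
  bounded_mfun f -> Ex (fun w => G w * f (Y w)) = c * Ex (fun w => f (Y w)).
Proof.
move=> bG hB bf; have [mG [C GC]] := bG.
have C0 : 0 <= C by apply: le_trans (GC point); exact: normr_ge0.
have mY : measurable_fun setT (Y : T -> R) by exact: measurable_funPT.
have bY (g : R -> R) : bounded_mfun g -> bounded_mfun (fun w => g (Y w)).
  exact: bounded_mfun_comp mY.
apply/eqP; rewrite -subr_eq0 -normr_le0 leNgt; apply/negP.
set D := `|_ - _| => D0.
pose eps := D / (2 * (C + `|c| + 1)).
have K0 : 0 < C + `|c| + 1 by rewrite ltr_wpDl // addr_ge0.
have e0 : 0 < eps by rewrite divr_gt0 // mulr_gt0.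
have [n [a [B [mB fB]]]] := simple_approximation e0 bf.
pose g x := \sum_(j < n) a j * \1_(B j) x.
have b1 j : bounded_mfun (\1_(B j) : R -> R) by exact: bounded_mfun_indic.
have b2 j : bounded_mfun (fun x : R => a j * \1_(B j) x).
  by apply: bounded_mfunM => //; exact: bounded_mfun_cst.
have bg : bounded_mfun g by apply: bounded_mfun_sum => j _; exact: b2.
have hg : Ex (fun w => G w * g (Y w)) = c * Ex (fun w => g (Y w)).
  have -> : (fun w => G w * g (Y w)) = (fun w => \sum_(j < n) a j * (G w * \1_(B j) (Y w))).
    by apply/funext => w; rewrite /g mulr_sumr; apply: eq_bigr => j _; rewrite mulrCA.
  rewrite !expect_sum => [|j _|j _]; last 2 first.
  - exact: (bY _ (b2 j)).
  - apply: bounded_mfunM; first exact: bounded_mfun_cst.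
    by apply: bounded_mfunM => //; exact: (bY _ (b1 j)).
  rewrite mulr_sumr; apply: eq_bigr => j _.
  have b3 : bounded_mfun (fun w => \1_(B j) (Y w) : R) := bY _ (b1 j).
  by rewrite (expectZ P _ (bounded_mfunM bG b3)) hB // [in RHS](expectZ P _ b3) mulrCA.
have bGf : bounded_mfun (fun w => G w * f (Y w)) by apply: bounded_mfunM => //; exact: bY.
have bGg : bounded_mfun (fun w => G w * g (Y w)) by apply: bounded_mfunM => //; exact: bY.
have h1 : `|Ex (fun w => G w * f (Y w)) - Ex (fun w => G w * g (Y w))| <= C * eps.
  rewrite -expectB //; apply: expect_norm_le => [|w]; first exact: bounded_mfunB.
  by rewrite -mulrBr normrM ler_pM.
have h2 : `|c * Ex (fun w => f (Y w)) - c * Ex (fun w => g (Y w))| <= `|c| * eps.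
  rewrite -mulrBr normrM ler_wpM2l // -expectB //; [|exact: bY|exact: bY].
  by apply: expect_norm_le => // ; apply: bounded_mfunB; exact: bY.
have : D <= (C + `|c|) * eps.
  rewrite /D; apply: (@le_trans _ _ (C * eps + `|c| * eps)); last by rewrite mulrDl.
  apply: le_trans (lerD h1 h2); rewrite hg.
  rewrite [X in _ <= _ + X]distrC.
  by apply: le_trans (ler_normD _ _); rewrite addrA subrK.
have : D = 2 * ((C + `|c| + 1) * eps) by rewrite /eps; field; rewrite gt_eqF.
nra.
Qed.
End IndependentProducts.

Section ProductFormula.
Context d (T : measurableType d) (R : realType) (P : probability T R).
Local Notation Ex := (expect P).

Lemma bounded_mfun_RV (Y : {RV P >-> R}) (f : R -> R) :
  bounded_mfun f -> bounded_mfun (fun w => f (Y w)).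
Proof. by apply: bounded_mfun_comp; exact: measurable_funPT. Qed.

Lemma expect_prod_indicators (I : finType) (D J : {set I}) (Y : I -> {RV P >-> R})
    (B : I -> set R) : independent_RVs D Y -> J \subset D ->
  (forall i, measurable (B i)) ->
  Ex (fun w => \prod_(i in J) \1_(B i) (Y i w)) = \prod_(i in J) Ex (fun w => \1_(B i) (Y i w)).
Proof.
move=> iY JD mB.
have mYB i : measurable (Y i @^-1` B i).
  by rewrite -[_ @^-1` _]setTI; apply: measurable_funPT.
have eP i : (Ex (fun w => \1_(B i) (Y i w)))%:E = P (Y i @^-1` B i).
  by rewrite -expect_indic.
have mcap : measurable (\bigcap_(i in [set` J]) (Y i @^-1` B i)).
  by apply: fin_bigcap_measurable => //; exact: finite_finset.
apply: EFin_inj; rewrite -prodEFin; under [RHS]eq_bigr do rewrite eP.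
rewrite -iY // -expect_indic //; congr ((Ex _)%:E); apply/funext => w.
rewrite indicE; case: (boolP (_ \in _)) => [|h].
  by rewrite inE => h; apply: big1 => i iJ; rewrite indicE mem_set //; exact: h.
have [i iJ wi] : exists2 i, i \in J & ~ (Y i @^-1` B i) w.
  apply: contrapT => H; move/negP: h; apply; rewrite inE => i /= iJ.
  by apply: contrapT => H2; apply: H; exists i.
by rewrite (bigD1 i) //= indicE memNset // mul0r.
Qed.

(** Independence is the case where all [f i] are indicators; [expect_mul_comp_ext]
    frees them one at a time, [s] listing those that are already arbitrary. *)
Lemma expect_prod_indep (I : finType) (D J : {set I}) (Y : I -> {RV P >-> R})
    (f : I -> R -> R) : independent_RVs D Y -> J \subset D ->
  (forall i, bounded_mfun (f i)) ->
  Ex (fun w => \prod_(i in J) f i (Y i w)) = \prod_(i in J) Ex (fun w => f i (Y i w)).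
Proof.
move=> iY JD.
suff H (s : seq I) : forall f : I -> R -> R, (forall i, bounded_mfun (f i)) ->
    (forall i, i \notin s -> exists2 B, measurable B & f i = \1_B) ->
    Ex (fun w => \prod_(i in J) f i (Y i w)) = \prod_(i in J) Ex (fun w => f i (Y i w)).
  by move=> bf; apply: (H (enum I)) => // i; rewrite mem_enum.
elim: s => [|k s IH] {}f bf hf.
  have /choice[B hB] : forall i, exists B, measurable B /\ f i = \1_B.
    by move=> i; have [//|B mB e] := hf i; exists B.
  have -> : f = fun i => \1_(B i) by apply/funext => i; case: (hB i).
  by apply: expect_prod_indicators iY JD _ => i; case: (hB i).
pose fB B i := if i == k then \1_B else f i.
have bfB B i : measurable B -> bounded_mfun (fB B i).
  by move=> mB; rewrite /fB; case: eqP => // _; exact: bounded_mfun_indic.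
have IHB B : measurable B -> Ex (fun w => \prod_(i in J) fB B i (Y i w)) =
    \prod_(i in J) Ex (fun w => fB B i (Y i w)).
  move=> mB; apply: IH => [i|i si]; first exact: bfB.
  rewrite /fB; case: eqP => [_|ik]; first by exists B.
  by apply: hf; rewrite inE negb_or si andbT; apply/eqP.
case: (boolP (k \in J)) => kJ; last first.
  have fE i : i \in J -> fB setT i = f i.
    by rewrite /fB; case: eqP => // ->; rewrite (negbTE kJ).
  have := IHB setT (@measurableT _ _).
  under [RHS]eq_bigr => i iJ do rewrite fE //.
  move=> <-; congr expect; apply/funext => w; apply: eq_bigr => i iJ; by rewrite fE.
have fBk B : fB B k = \1_B by rewrite /fB eqxx.
have fBn B i : i != k -> fB B i = f i by rewrite /fB => /negbTE ->.
pose G w := \prod_(i in J | i != k) f i (Y i w).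
pose c := \prod_(i in J | i != k) Ex (fun w => f i (Y i w)).
have bG : bounded_mfun G by apply: bounded_mfun_prod => i _; exact: bounded_mfun_RV.
rewrite [RHS](bigD1 k) //= -/c mulrC -(expect_mul_comp_ext (G := G)) //.
  by congr expect; apply/funext => w; rewrite (bigD1 k) //= mulrC.
move=> B mB; have := IHB B mB; rewrite [RHS](bigD1 k) //= fBk.
under [X in _ = _ * X]eq_bigr => i /andP[_ ik] do rewrite fBn //.
rewrite -/c mulrC => <-; congr expect; apply/funext => w.
rewrite (bigD1 k) //= fBk mulrC; congr (_ * _).
by apply: eq_bigr => i /andP[_ ik]; rewrite fBn.
Qed.

Lemma expect_law (rho : probability R R) (Y : {RV P >-> R}) (f : R -> R) :
  (forall B, measurable B -> distribution P Y B = rho B) ->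
  bounded_mfun f -> Ex (fun w => f (Y w)) = expect rho f.
Proof.
move=> law bf; rewrite /expect /Rintegral; congr fine.
have -> : (\int[rho]_x (f x)%:E = \int[distribution P Y]_x (f x)%:E)%E.
  by apply: eq_measure_integral => A mA _; exact/esym/law.
rewrite integral_distribution //.
  by apply/measurable_EFinP; case: bf.
apply: (@bounded_mfun_integrable _ _ _ P); exact: bounded_mfun_RV.
Qed.
End ProductFormula.

(** * Truncation of the entries *)

Section Truncation.
Context (R : realType) (rho : probability R R).
Hypothesis rho_moments : forall k : nat, rho.-integrable setT (fun x : R => (x ^+ k)%:E).
Implicit Types (L : nat) (x : R).

Definition truncate L x : R := if `|x| <= L%:R then x else 0.
Definition truncated_mean L := expect rho (truncate L).
(** Subtracting the mean of the truncated law changes the matrix of truncated entries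
    by a matrix of rank one; see [sample_sub_truncated]. *)
Definition centered L x := truncate L x - truncated_mean L.
Definition centered_moment L k := expect rho (fun x => centered L x ^+ k).
Definition moment k : R := \int[rho]_x (x ^+ k).

Lemma truncate_norm_le L x : `|truncate L x| <= L%:R.
Proof. by rewrite /truncate; case: ifP => // _; rewrite normr0. Qed.

Lemma measurable_truncate L : measurable_fun setT (truncate L).
Proof.
rewrite /truncate; apply: measurable_fun_if => //.
  by apply: measurable_fun_ler => //; exact: measurableT_comp.
Qed.

Lemma bounded_truncate L : bounded_mfun (truncate L).
Proof. by split; [exact: measurable_truncate|exists L%:R; exact: truncate_norm_le]. Qed.

Lemma truncated_mean_norm_le L : `|truncated_mean L| <= L%:R.
Proof. by apply: expect_norm_le; [exact: bounded_truncate|exact: truncate_norm_le]. Qed.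

Lemma centered_norm_le L x : `|centered L x| <= 2 * L%:R.
Proof.
rewrite (le_trans (ler_normB _ _)) // mulr_natl mulr2n lerD //.
  exact: truncate_norm_le.
exact: truncated_mean_norm_le.
Qed.

Lemma bounded_centered L : bounded_mfun (centered L).
Proof. by apply: bounded_mfunB; [exact: bounded_truncate|exact: bounded_mfun_cst]. Qed.

Lemma centered_moment0 L : centered_moment L 0 = 1.
Proof. by rewrite /centered_moment; under eq_fun do rewrite expr0; rewrite expect_cst. Qed.

Lemma centered_moment1 L : centered_moment L 1 = 0.
Proof.
rewrite /centered_moment; under eq_fun do rewrite expr1.
rewrite expectB ?expect_cst ?subrr //; [exact: bounded_truncate|exact: bounded_mfun_cst].
Qed.

Lemma centered_moment2_ge0 L : 0 <= centered_moment L 2.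
Proof. by apply: expect_ge0 => x; exact: sqr_ge0. Qed.

Definition sigma L := Num.sqrt (centered_moment L 2).

Lemma sigma_sqr L : sigma L ^+ 2 = centered_moment L 2.
Proof. by rewrite sqr_sqrtr // centered_moment2_ge0. Qed.

Lemma centered_moment_le L k : `|centered_moment L k.+2| <= sigma L ^+ 2 * (2 * L%:R) ^+ k.
Proof.
have bX k' : bounded_mfun (fun x => centered L x ^+ k') by exact/bounded_mfunX/bounded_centered.
rewrite sigma_sqr /centered_moment mulrC -expectZ //; apply: le_norm_expect => //.
  by apply: bounded_mfunM => //; exact: bounded_mfun_cst.
move=> x; rewrite -addn2 exprD normrM [X in _ * X]ger0_norm ?sqr_ge0 // ler_wpM2r ?sqr_ge0 //.
by rewrite normrX lerXn2r ?nnegrE ?mulr_ge0 // centered_norm_le.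
Qed.

Lemma sigma_ge0 L : 0 <= sigma L.
Proof. exact: sqrtr_ge0. Qed.

Lemma sigma_le L : sigma L <= 2 * L%:R.
Proof.
rewrite -(@ler_pXn2r _ 2) ?nnegrE ?sigma_ge0 ?mulr_ge0 // sigma_sqr.
apply: (le_trans (ler_norm _)); apply: expect_norm_le.
  exact/bounded_mfunX/bounded_centered.
by move=> x; rewrite normrX lerXn2r ?nnegrE ?mulr_ge0 // centered_norm_le.
Qed.

Lemma centered_moment_norm_le L k : `|centered_moment L k| <= (2 * L%:R) ^+ k.
Proof.
apply: expect_norm_le; first exact/bounded_mfunX/bounded_centered.
by move=> x; rewrite normrX lerXn2r ?nnegrE ?mulr_ge0 // centered_norm_le.
Qed.

(** The error is carried by [`|x| > L], where [(`|x| / L) ^+ q] exceeds one. *)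
Lemma truncate_error_le k q L x : (0 < L)%N -> ~~ odd (k + q) ->
  `|x ^+ k - truncate L x ^+ k| <= (0 < k)%N%:R * (x ^+ (k + q) / L%:R ^+ q).
Proof.
move=> L0 ev; case: k ev => [|k] ev; first by rewrite !expr0 subrr normr0 mul0r.
have xp : x ^+ (k.+1 + q) = `|x| ^+ (k.+1 + q).
  by rewrite -(odd_double_half (k.+1 + q)) (negbTE ev) add0n -mul2n !exprM real_normK ?num_real.
have Lq : 0 < L%:R ^+ q :> R by rewrite exprn_gt0 // ltr0n.
rewrite /= mul1r xp /truncate; case: ifP => [_|/negbT].
  by rewrite subrr normr0 divr_ge0 ?exprn_ge0.
rewrite -ltNge => Lx; rewrite expr0n /= subr0 normrX exprD -mulrA ler_peMr ?exprn_ge0 //.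
by rewrite ler_pdivlMr // mul1r lerXn2r ?nnegrE ?(ltW Lx).
Qed.

Lemma expect_truncate_close k q L : (0 < L)%N -> ~~ odd (k + q) ->
  `|moment k - expect rho (fun x => truncate L x ^+ k)| <= moment (k + q) / L%:R ^+ q.
Proof.
move=> L0 ev; have bt : bounded_mfun (fun x => truncate L x ^+ k) by exact/bounded_mfunX/bounded_truncate.
have it := bounded_mfun_integrable rho bt.
have ik := rho_moments k; have ikq := rho_moments (k + q).
rewrite /moment /expect -RintegralB //.
have iB : rho.-integrable setT (EFin \o (fun x => x ^+ k - truncate L x ^+ k)).
  by have := integrableB measurableT ik it; apply: eq_integrable.
apply: le_trans (le_normr_Rintegral measurableT iB) _.
rewrite -RintegralZr //; apply: le_Rintegral => //.
- by have := integrable_norm iB; apply: eq_integrable.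
- by have := integrableZr measurableT (L%:R ^+ q)^-1 ikq; apply: eq_integrable.
- move=> x _; apply: (le_trans (truncate_error_le x L0 ev)).
  have xp : 0 <= x ^+ (k + q).
    by rewrite -(odd_double_half (k + q)) (negbTE ev) add0n -mul2n exprM exprn_ge0 ?sqr_ge0.
  apply: ler_piMl; last by rewrite lern1 leq_b1.
  by apply: divr_ge0 => //; apply: exprn_ge0.
Qed.

Lemma measurable_tail_set L : measurable [set x : R | (L%:R < `|x|)%R].
Proof.
rewrite (_ : [set _ | _] = (fun x : R => `|x|) @^-1` `]L%:R, +oo[%classic); last first.
  by apply/seteqP; split => w /=; rewrite in_itv /= andbT.
by rewrite -[_ @^-1` _]setTI; apply: measurableT_comp => //; exact: measurable_itv.
Qed.

Lemma tail_le q L : (0 < L)%N ->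
  (rho [set x | (L%:R < `|x|)%R] <= (moment (2 * q) / L%:R ^+ (2 * q))%:E)%E.
Proof.
move=> L0; have mA := measurable_tail_set L.
have ikq := rho_moments (2 * q).
rewrite -expect_indic // lee_fin /moment -RintegralZr //; apply: le_Rintegral => //.
- exact/bounded_mfun_integrable/bounded_mfun_indic.
- by have := integrableZr measurableT (L%:R ^+ (2 * q))^-1 ikq; apply: eq_integrable.
- move=> x _; have Lq : 0 < L%:R ^+ (2 * q) :> R by rewrite exprn_gt0 // ltr0n.
  rewrite indicE; case: (boolP (_ \in _)) => [|_]; last first.
    by rewrite divr_ge0 // ?(ltW Lq) // exprM exprn_ge0 ?sqr_ge0.
  rewrite inE /= => Lx; rewrite ler_pdivlMr // mul1r -[x ^+ _]ger0_norm; last first.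
    by rewrite exprM exprn_ge0 ?sqr_ge0.
  by rewrite normrX lerXn2r ?nnegrE // ltW.
Qed.

Lemma cvg_of_dist_le_div (u : nat -> R) l C :
  (forall L, (0 < L)%N -> `|l - u L| <= C / L%:R) -> u @ \oo --> l.
Proof.
move=> h; apply/cvgrPdist_le => e e0; near=> L.
have L0 : (0 < L)%N by near: L; exists 1%N.
apply: le_trans (h L L0) _; rewrite ler_pdivrMr ?ltr0n // -ler_pdivrMl //.
by near: L; exact: nbhs_infty_ger.
Unshelve. all: by end_near. Qed.

Lemma cvg_sigma_sqr v : v = moment 2 - moment 1 ^+ 2 ->
  (fun L => sigma L ^+ 2) @ \oo --> v.
Proof.
move=> ->; have e L : sigma L ^+ 2 =
    expect rho (fun x => truncate L x ^+ 2) - truncated_mean L ^+ 2.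
  have bt := bounded_truncate L; have b2 := bounded_mfunX 2 bt.
  have bc c : bounded_mfun (fun _ : R => c : R) by exact: bounded_mfun_cst.
  rewrite sigma_sqr /centered_moment /centered; set m := truncated_mean L.
  have -> : (fun x => (truncate L x - m) ^+ 2) =
    (fun x => (truncate L x ^+ 2 - (2 * m) * truncate L x) + m ^+ 2) by apply/funext => x; ring.
  have bm := bounded_mfunM (bc (2 * m)) bt.
  rewrite expectD //; last exact: bounded_mfunB.
  by rewrite expect_cst expectB // expectZ // -/(truncated_mean L) -/m; ring.
under eq_fun do rewrite e.
apply: cvgB.
  apply: (@cvg_of_dist_le_div _ _ (moment 4)) => L L0.
  apply: le_trans (@expect_truncate_close 2 2 L L0 isT) _.
  have m4 : 0 <= moment 4 by apply: Rintegral_ge0 => x _; rewrite (exprM _ 2 2) sqr_ge0.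
  apply: ler_wpM2l => //; rewrite lef_pV2 ?posrE ?exprn_gt0 ?ltr0n //.
  by rewrite expr2 ler_peMr // ler1n.
have h : truncated_mean @ \oo --> moment 1.
  apply: (@cvg_of_dist_le_div _ _ (moment 2)) => L L0.
  have := @expect_truncate_close 1 1 L L0 isT; rewrite expr1 /truncated_mean.
  by under [X in expect rho X]eq_fun do rewrite expr1.
under eq_fun do rewrite expr2; rewrite expr2; exact: cvgM.
Qed.
End Truncation.

(** * Trace moments of the truncated ensemble *)

Section TruncatedWigner.
Context d (T : measurableType d) (R : realType) (P : probability T R)
  (X : forall N : nat, 'M[{RV P >-> R}]_N) (rho : probability R R) (m v : R).
Hypothesis hX : wigner_ensemble m v X rho.
Variables (L N : nat).
Local Notation V := 'I_N.
Local Notation Ex := (expect P).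
Local Notation mom := (centered_moment rho L).

Definition truncated_sample (w : T) : 'M[R]_N := \matrix_(i, j) centered rho L (X N i j w).
Local Notation W := truncated_sample.

Lemma truncated_sample_sym w : (W w)^T = W w.
Proof.
apply/matrixP => i j; rewrite !mxE; congr centered.
have /matrixP/(_ i j) := wigner_symmetric hX N w.
by rewrite !mxE.
Qed.

Lemma sample_sub_truncated w : (forall i j, `|X N i j w| <= L%:R) ->
  (\rank (sample (X N) w - W w)%R <= 1)%N.
Proof.
move=> XL; have -> : sample (X N) w - W w = const_mx (truncated_mean rho L).
  apply/matrixP => i j; rewrite !mxE /centered /truncate XL; ring.
have -> : (const_mx (truncated_mean rho L) : 'M[R]_N) =
    (const_mx 1 : 'cV[R]_N) *m (const_mx (truncated_mean rho L) : 'rV[R]_N).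
  by apply/matrixP => i j; rewrite !mxE big_ord1 !mxE mul1r.
apply: leq_trans (mxrankM_maxl _ _) _; exact: (rank_leq_col (const_mx 1 : 'cV[R]_N)).
Qed.

Lemma bounded_entry i j : bounded_mfun (fun w => W w i j).
Proof.
under eq_fun do rewrite mxE; apply: (@bounded_mfun_RV _ _ _ P (X N i j) (centered rho L)).
exact: bounded_centered.
Qed.

Lemma bounded_exprmx n i j : bounded_mfun (fun w => (W w ^+ n) i j).
Proof.
elim: n i j => [|n IH] i j.
  by under eq_fun do rewrite expr0 mxE; exact: bounded_mfun_cst.
under eq_fun do rewrite exprmxS_entry; apply: bounded_mfun_sum => k _.
by apply: bounded_mfunM => //; exact: bounded_entry.
Qed.

Lemma bounded_trace n : bounded_mfun (fun w => \tr (W w ^+ n)).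
Proof. by apply: bounded_mfun_sum => i _; exact: bounded_exprmx. Qed.

Lemma bounded_edge_prod h : bounded_mfun (fun w => edge_prod (W w) h).
Proof. by apply: bounded_mfun_prod => e _; exact: bounded_entry. Qed.

Lemma prod_count_mem (F : V * V -> R) h : \prod_(e <- h) F e = \prod_e F e ^+ count_mem e h.
Proof.
elim: h => [|f h IH]; first by rewrite big_nil big1.
rewrite big_cons IH (bigD1 f) // [in RHS](bigD1 f) // count_mem_cons eqxx add1n exprS.
rewrite [in RHS](eq_bigr (fun e => F e ^+ count_mem e h)) => [|e ef].
  by rewrite /= mulrA.
by rewrite count_mem_other.
Qed.

Definition upper_edges : {set V * V} := [set ij : V * V | (ij.1 <= ij.2)%N]%SET.

Lemma ed_upper (i j : V) : ed i j \in upper_edges.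
Proof. by rewrite inE /ed; case: ifP => //= /negbT; rewrite -ltnNge => /ltnW. Qed.

(** Grouping equal positions turns the product into one over independent entries. *)
Lemma expect_edge_prod h : all (mem upper_edges) h ->
  Ex (fun w => edge_prod (W w) h) = moment_weight mom h.
Proof.
move=> /allP hU; pose f (e : V * V) (x : R) := centered rho L x ^+ count_mem e h.
have cU e : e \notin upper_edges -> count_mem e h = 0%N.
  by move=> eU; apply/count_memPn; apply: contra eU; exact: hU.
transitivity (Ex (fun w => \prod_(e in upper_edges) f e (X N e.1 e.2 w))).
  congr expect; apply/funext => w; rewrite /edge_prod prod_count_mem [RHS]big_mkcond.
  apply: eq_bigr => e _; rewrite mxE /f; case: ifPn => // /cU ->; by rewrite expr0.
have iX : independent_RVs upper_edges (fun ij => X N ij.1 ij.2) by exact: (wigner_independent hX).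
rewrite (expect_prod_indep iX) //; last first.
  by move=> e; exact/bounded_mfunX/bounded_centered.
rewrite /moment_weight [RHS](bigID (mem upper_edges)) /= [X in _ * X]big1 ?mulr1; last first.
  by move=> e /cU ->; exact: centered_moment0.
apply: eq_bigr => e _; apply: expect_law; first exact: (wigner_law hX).
exact/bounded_mfunX/bounded_centered.
Qed.

(** Expanding [W ^+ n.+1] along its first factor adds one edge to the history. *)
Lemma expect_walk n h i j : all (mem upper_edges) h ->
  Ex (fun w => edge_prod (W w) h * (W w ^+ n) i j) = walk_sum mom n h i j.
Proof.
elim: n h i => [|n IH] h i hU.
  rewrite /= -(expect_edge_prod hU) -expectZ; last exact: bounded_edge_prod.
  by congr expect; apply/funext => w; rewrite expr0 mxE mulrC.
transitivity (\sum_k Ex (fun w => edge_prod (W w) (ed i k :: h) * (W w ^+ n) k j)); last first.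
  by apply: eq_bigr => k _; apply: IH; rewrite /= hU andbT ed_upper.
rewrite -expect_sum => [|k _]; last first.
  by apply: bounded_mfunM; [exact: bounded_edge_prod|exact: bounded_exprmx].
congr expect; apply/funext => w; rewrite exprmxS_entry mulr_sumr; apply: eq_bigr => k _.
by rewrite edge_prod_cons_ed ?truncated_sample_sym // mulrCA mulrA.
Qed.

Lemma expect_trace n :
  Ex (fun w => \tr (W w ^+ n)) = \sum_(i < N) walk_sum mom n [::] i i.
Proof.
rewrite expect_sum => [|i _]; last exact: bounded_exprmx.
apply: eq_bigr => i _; rewrite -(@expect_walk n [::] i i isT); congr expect; apply/funext => w.
by rewrite /edge_prod big_nil mul1r.
Qed.

Lemma cycle_edges_upper (c : seq V) : all (mem upper_edges) (@cycle_edges N c).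
Proof.
case: c => // x s; rewrite /cycle_edges; move: (rcons s x) => t.
by elim: t x => //= y t IH x; rewrite ed_upper IH.
Qed.

Definition trace_variance n :=
  Ex (fun w => (\tr (W w ^+ n) - Ex (fun w => \tr (W w ^+ n))) ^+ 2).

Lemma trace_variance_le n : (0 < n)%N ->
  trace_variance n <= N%:R ^+ n * (n%:R ^+ n * n%:R ^+ n) * (2 * (2 * L%:R) ^+ (n + n)).
Proof.
case: n => // n _; set p := n.+1; rewrite /trace_variance; set c := Ex (fun w => \tr (W w ^+ p)).
have bt := bounded_trace p; have bt2 := bounded_mfunX 2 bt.
have bc x : bounded_mfun (fun _ : T => x : R) by exact: bounded_mfun_cst.
have eT w : \tr (W w ^+ p) = \sum_(s : p.-tuple V) edge_prod (W w) (cycle_edges s).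
  by rewrite mxtrace_exprS // truncated_sample_sym.
have ec : c = \sum_(s : p.-tuple V) moment_weight mom (cycle_edges s).
  transitivity (Ex (fun w => \sum_(s : p.-tuple V) edge_prod (W w) (cycle_edges s))).
    by congr expect; apply/funext => w; exact: eT.
  rewrite expect_sum => [|s _]; last exact: bounded_edge_prod.
  by apply: eq_bigr => s _; rewrite expect_edge_prod // cycle_edges_upper.
have e2 : Ex (fun w => \tr (W w ^+ p) ^+ 2) =
    \sum_(s1 : p.-tuple V) \sum_(s2 : p.-tuple V) moment_weight mom (cycle_edges s1 ++ cycle_edges s2).
  transitivity (Ex (fun w => \sum_(s1 : p.-tuple V) \sum_(s2 : p.-tuple V)
      edge_prod (W w) (cycle_edges s1 ++ cycle_edges s2))).
    congr expect; apply/funext => w; rewrite eT expr2 mulr_suml; apply: eq_bigr => s1 _.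
    by rewrite mulr_sumr; apply: eq_bigr => s2 _; rewrite /edge_prod big_cat.
  rewrite expect_sum => [|s1 _]; last by apply: bounded_mfun_sum => s2 _; exact: bounded_edge_prod.
  apply: eq_bigr => s1 _; rewrite expect_sum => [|s2 _]; last exact: bounded_edge_prod.
  by apply: eq_bigr => s2 _; rewrite expect_edge_prod // all_cat !cycle_edges_upper.
have -> : (fun w => (\tr (W w ^+ p) - c) ^+ 2) =
    (fun w => (\tr (W w ^+ p) ^+ 2 - (2 * c) * \tr (W w ^+ p)) + c ^+ 2).
  by apply/funext => w; ring.
have bcm := bounded_mfunM (bc (2 * c)) bt.
rewrite expectD //; last exact: bounded_mfunB.
rewrite expect_cst expectB // expectZ // -/c e2.
rewrite (_ : _ + _ = \sum_(s1 : p.-tuple V) \sum_(s2 : p.-tuple V)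
   (moment_weight mom (cycle_edges s1 ++ cycle_edges s2)
    - moment_weight mom (cycle_edges s1) * moment_weight mom (cycle_edges s2))).
  apply: le_trans (ler_norm _) _; apply: covariance_sum_le => //.
  - exact: centered_moment0.
  - exact: centered_moment1.
  - exact: centered_moment_norm_le.
have -> : forall x : R, x - 2 * c * c + c ^+ 2 = x - c * c by move=> x; ring.
under [RHS]eq_bigr do rewrite sumrB; rewrite sumrB; congr (_ - _).
rewrite {1}ec mulr_suml; apply: eq_bigr => s1 _; by rewrite ec mulr_sumr.
Qed.

Section Rates.
Hypothesis N0 : (0 < N)%N.
Variable l : nat.
Hypothesis l0 : (0 < l)%N.
Local Notation rt := (Num.sqrt (N%:R : R)).
Local Notation rate := (walk_rate (sigma rho L) (2 * L%:R) rt l).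

Let rt1 : 1 <= rt. Proof. by rewrite -[leLHS]sqrtr1 ler_sqrt ?ltr01 // ler1n. Qed.
Let rtN : rt ^+ 2 = N%:R. Proof. by rewrite sqr_sqrtr. Qed.

Lemma expect_trace_le n : (n <= l)%N ->
  Ex (fun w => \tr (W w ^+ n)) <= N%:R * rate ^+ n.
Proof.
move=> nl; rewrite expect_trace; apply: le_trans (ler_norm _) _.
apply: closed_walk_sum_le => //.
- exact: sigma_ge0.
- exact: sigma_le.
- exact: centered_moment0.
- exact: centered_moment1.
- exact: centered_moment_le.
Qed.

Lemma expect_trace_approx n : (n <= l)%N ->
  `|Ex (fun w => \tr (W w ^+ n)) - N%:R * (sigma rho L ^+ n * rt ^+ n * (ballot n 0)%:R)|
  <= N%:R * (2 * exceptional_cost (2 * L%:R) l * n%:R * rate ^+ n.-1).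
Proof.
move=> nl; rewrite expect_trace; apply: closed_walk_sum_approx => //.
- exact: sigma_ge0.
- exact: sigma_le.
- exact: centered_moment0.
- exact: centered_moment1.
- exact: centered_moment_le.
- by rewrite sigma_sqr.
Qed.
End Rates.
End TruncatedWigner.

(** * Measurability of limits, summable events and growth rates *)

Lemma exists_inv_natS_le (R : realType) (e : R) : 0 < e -> exists j : nat, j.+1%:R^-1 <= e.
Proof.
move=> e0; exists (Num.truncn e^-1); rewrite -[leRHS]invrK lef_pV2 ?posrE ?invr_gt0 ?ltr0n //.
by apply: ltW; exact: truncnS_gt.
Qed.

Section MeasurabilityOfLimits.
Context d (T : measurableType d) (R : realType).

Lemma measurable_fun_le_sets (f : T -> R) :
  (forall t, measurable [set w | f w <= t]) -> measurable_fun setT f.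
Proof.
move=> h mD; apply: (measurability _ (RGenOInfty.measurableE R)) => //.
move=> /= _ [_ [a ->] <-]; rewrite preimage_itvoy setTI.
rewrite (_ : [set _ | _] = ~` [set w | f w <= a]); first exact: measurableC.
by apply/seteqP; split => w /=; rewrite ltNge => /negP.
Qed.

Lemma measurable_le_set (f g : T -> R) : measurable_fun setT f -> measurable_fun setT g ->
  measurable [set w | f w <= g w].
Proof.
move=> mf mg.
rewrite (_ : [set w | _] = setT `&` (fun w => f w <= g w) @^-1` [set true]).
  by apply: (measurable_fun_ler mf mg measurableT).
by rewrite setTI.
Qed.

Lemma measurable_cvg_set (f : nat -> T -> R) (l : R) : (forall n, measurable_fun setT (f n)) ->
  measurable [set w | f n w @[n --> \oo] --> l].
Proof.
move=> mf; rewrite (_ : [set _ | _] = \bigcap_j \bigcup_M \bigcap_(n in [set n | (M <= n)%N])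
    [set w | `|l - f n w| <= j.+1%:R^-1]).
  apply: bigcap_measurable => [|j _]; first by exists 0%N.
  apply: bigcup_measurable => M _; apply: bigcap_measurable => [|n _]; first by exists M => /=.
  apply: measurable_le_set => //; apply: measurableT_comp => //.
  by apply: measurable_funB.
apply/seteqP; split => w /= h.
  move=> j _; move/cvgrPdist_le : h => /(_ j.+1%:R^-1); rewrite invr_gt0 ltr0n => /(_ isT).
  by case=> M _ hM; exists M => // n /= Mn; exact: hM.
apply/cvgrPdist_le => e e0.
have [j je] := exists_inv_natS_le e0.
have [M _ hM] := h j I; exists M => // n /= Mn.
by apply: le_trans je; exact: hM.
Qed.
End MeasurabilityOfLimits.

Section BorelCantelli.
Context d (T : measurableType d) (R : realType) (P : probability T R).

(** Compares [n ^ (-3/2)] with a telescoping difference. *)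
Lemma inv_three_halves_le n :
  (n.+2%:R * Num.sqrt n.+2%:R)^-1 <= 2 * ((Num.sqrt n.+1%:R)^-1 - (Num.sqrt n.+2%:R)^-1) :> R.
Proof.
set a := Num.sqrt n.+1%:R; set b := Num.sqrt n.+2%:R.
have a0 : 0 < a :> R by rewrite sqrtr_gt0 ltr0n.
have b0 : 0 < b :> R by rewrite sqrtr_gt0 ltr0n.
have a2 : a ^+ 2 = n.+1%:R by rewrite sqr_sqrtr.
have b2 : b ^+ 2 = n.+2%:R by rewrite sqr_sqrtr.
have ab : a <= b by rewrite ler_sqrt ?ler_nat ?ltr0n.
have e1 : b ^+ 2 - a ^+ 2 = 1 by rewrite a2 b2 -[n.+2%:R]natr1; ring.
rewrite -b2.
have -> : a^-1 - b^-1 = (a * b * (a + b))^-1.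
  rewrite -[RHS]mul1r -e1; field.
  by rewrite !gt_eqF // addr_gt0.
have -> : 2 * (a * b * (a + b))^-1 = (a * b * ((a + b) / 2))^-1.
  by field; rewrite !gt_eqF // addr_gt0.
rewrite lef_pV2 ?posrE ?mulr_gt0 ?exprn_gt0 ?addr_gt0 ?invr_gt0 ?ltr0n // expr2.
apply: ler_pM; rewrite ?mulr_ge0 ?addr_ge0 ?invr_ge0 ?(ltW a0) ?(ltW b0) ?ler0n //.
  by rewrite ler_wpM2r // ltW.
lra.
Qed.

(** The rate [n ^ (-3/2)] is summable and leaves room for a factor [sqrt n] over the
    rate [n ^ (-2)] of the variances. *)
Lemma borel_cantelli_rate (B : nat -> set T) (C : R) : (forall n, measurable (B n)) ->
  (\forall n \near \oo, (P (B n) <= (C * (n%:R * Num.sqrt n%:R)^-1)%:E)%E) ->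
  {ae P, forall w, \forall n \near \oo, ~ B n w}.
Proof.
move=> mB [n0 _ hn0].
pose F n := if (n0 <= n)%N then (if (2 <= n)%N then B n else set0) else set0.
have mF n : measurable (F n) by rewrite /F; case: ifP => // _; case: ifP.
suff L0 : P (lim_sup_set F) = 0%E.
  exists (lim_sup_set F); split => //.
    by apply: bigcap_measurable => [|k _]; [exists 0%N|apply: bigcup_measurable => j _].
  move=> w /= nw n _; apply: contrapT => hn; apply: nw.
  exists (maxn n (maxn n0 2)) => // k /=; rewrite !geq_max => /and3P[nk n0k k2] Bk.
  by apply: hn; exists k => //; rewrite /F n0k k2.
apply: lim_sup_set_cvg0 => //.
pose D := `|C|; have D0 : 0 <= D by exact: normr_ge0.
have PF n : (P (F n) <= (if n is n'.+2 then D * (2 * ((Num.sqrt n'.+1%:R)^-1 - (Num.sqrt n'.+2%:R)^-1)) else 0)%:E)%E.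
  rewrite /F; case: (leqP n0 n) => h; last first.
    rewrite measure0 lee_fin; case: n h => [|[|n]] // _; apply: mulr_ge0; first exact: normr_ge0.
    by apply: le_trans (inv_three_halves_le n); rewrite invr_ge0 mulr_ge0 // sqrtr_ge0.
  case: n h => [|[|n]] h /=; rewrite ?measure0 //.
  apply: (le_trans (hn0 _ h)); rewrite lee_fin.
  apply: le_trans (ler_wpM2l (normr_ge0 C) (inv_three_halves_le n)).
  by apply: ler_wpM2r; [rewrite invr_ge0 mulr_ge0 // sqrtr_ge0|exact: ler_norm].
apply: (@le_lt_trans _ _ (D * 2)%:E); last exact: ltry.
apply: lime_le; first by apply: is_cvg_nneseries => n _ _; exact: measure_ge0.
apply: nearW => n; apply: (le_trans (lee_sum _ (fun i _ => PF i))).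
rewrite sumEFin lee_fin.
have H k : \sum_(0 <= i < k.+2) (if i is n'.+2 then D * (2 * ((Num.sqrt n'.+1%:R)^-1 - (Num.sqrt n'.+2%:R)^-1)) else 0)
    = D * 2 * (1 - (Num.sqrt k.+1%:R)^-1) :> R.
  elim: k => [|k IH]; first by rewrite !big_nat_recr //= big_geq // sqrtr1 invr1 subrr mulr0 !addr0.
  by rewrite big_nat_recr //= IH; ring.
case: n => [|[|n]]; first by rewrite big_geq // mulr_ge0.
  by rewrite big_nat1 mulr_ge0.
rewrite H ler_piMr ?mulr_ge0 // gerBl invr_ge0 sqrtr_ge0 //.
Qed.
End BorelCantelli.

Section PolynomialGeometric.
Variable R : realType.

Lemma one_plus_pow_le (x : R) a : 0 <= x <= 1 -> (1 + x) ^+ a <= 1 + (2 ^+ a - 1) * x.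
Proof.
move=> /andP[x0 x1]; elim: a => [|a IH]; first by rewrite !expr0 subrr mul0r addr0.
rewrite exprS; apply: (le_trans (ler_wpM2l _ IH)); first by rewrite addr_ge0.
have : 1 <= 2 ^+ a :> R by rewrite exprn_ege1 // ler1n.
rewrite (exprS _ a); move: (2 ^+ a) => y y1.
rewrite -subr_ge0 (_ : _ - _ = (y - 1) * x * (1 - x)); last by ring.
by rewrite !mulr_ge0 // subr_ge0.
Qed.

(** If [(1 + x) ^+ a <= 1 + h] then [(1 + h) ^+ n] is at least
    [((1 + x) ^+ n) ^+ a >= (n * x) ^+ a]. *)
Lemma poly_geometric_bounded (a : nat) (h : R) : 0 < h ->
  exists C, forall n : nat, n%:R ^+ a <= C * (1 + h) ^+ n.
Proof.
move=> h0; pose x := Num.min h 1 / 2 ^+ a.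
have p0 : 0 < 2 ^+ a :> R by rewrite exprn_gt0.
have x0 : 0 < x by rewrite divr_gt0 // lt_min h0 ltr01.
have x1 : x <= 1.
  rewrite ler_pdivrMr // mul1r; apply: (@le_trans _ _ 1); first by rewrite ge_min lexx orbT.
  by rewrite exprn_ege1 // ler1n.
have xh : (1 + x) ^+ a <= 1 + h.
  apply: (le_trans (one_plus_pow_le _ _)); first by rewrite (ltW x0).
  rewrite lerD2l; apply: (@le_trans _ _ (2 ^+ a * x)).
    by apply: ler_wpM2r; [exact: ltW|rewrite gerBl].
  by rewrite /x mulrC divfK ?gt_eqF // ge_min lexx.
clearbody x; exists (x ^- a) => n.
rewrite mulrC -ler_pdivrMr ?invr_gt0 ?exprn_gt0 // invrK -exprMn.
apply: (@le_trans _ _ (((1 + x) ^+ n) ^+ a)).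
  apply: lerXn2r; rewrite ?nnegrE ?mulr_ge0 ?exprn_ge0 ?addr_ge0 ?(ltW x0) //.
  by apply: le_trans (bernoulli_le n (ltW x0)); rewrite lerDr.
rewrite -exprM mulnC exprM; apply: lerXn2r => //; rewrite nnegrE ?exprn_ge0 ?addr_ge0 ?(ltW x0) //.
exact: ltW.
Qed.
End PolynomialGeometric.

Section RootFloor.
Definition root_floor q N := (\max_(L < N.+1 | (L ^ q <= N)%N) L)%N.

Lemma root_floor_ge q N L : (0 < q)%N -> (L ^ q <= N)%N -> (L <= root_floor q N)%N.
Proof.
move=> q0 LN; have LN' : (L < N.+1)%N.
  rewrite ltnS; apply: leq_trans LN; case: L => // L.
  by rewrite -[X in (X <= _)%N]expn1 leq_pexp2l.
by rewrite /root_floor (leq_bigmax_cond (Ordinal LN')).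
Qed.

Lemma root_floor_exp_le q N : (0 < q)%N -> (root_floor q N ^ q <= N)%N.
Proof.
move=> q0; have h : (0 < #|[pred L : 'I_N.+1 | (L ^ q <= N)%N]|)%N.
  by apply/card_gt0P; exists ord0; rewrite inE /= exp0n.
have [i hi e] := eq_bigmax_cond (fun i : 'I_N.+1 => i : nat) h.
have -> : root_floor q N = i by rewrite -e; apply: eq_bigl.
by move: hi; rewrite inE.
Qed.

Lemma root_floor_exp_gt q N : (0 < q)%N -> (N < (root_floor q N).+1 ^ q)%N.
Proof. by move=> q0; rewrite ltnNge; apply/negP => /(root_floor_ge q0); rewrite ltnn. Qed.
End RootFloor.

(** * Rare events *)

Section Asymptotics.
Context d (T : measurableType d) (R : realType) (P : probability T R)
  (X : forall N : nat, 'M[{RV P >-> R}]_N) (rho : probability R R) (m v : R).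
Hypothesis hX : wigner_ensemble m v X rho.
Variable q : nat.
Hypothesis q10 : (10 <= q)%N.
Local Notation Ex := (expect P).
Local Notation level := (root_floor q).
Local Notation W N w := (truncated_sample X rho (level N) N w).
Local Notation rt N := (Num.sqrt (N%:R : R)).

Let q0 : (0 < q)%N. Proof. by apply: leq_trans q10. Qed.

Lemma level_cvg : level @ \oo --> \oo.
Proof.
apply/cvgnyPge => M; exists (M ^ q)%N => // N /= MN; exact: root_floor_ge.
Qed.

Lemma level_gt0 N : (0 < N)%N -> (0 < level N)%N.
Proof. by move=> N0; apply: root_floor_ge => //; rewrite exp1n. Qed.

Lemma level_exp_le a N : (0 < N)%N -> (a <= q)%N -> (level N ^ a <= N)%N.
Proof.
move=> N0 aq; apply: leq_trans (root_floor_exp_le N q0).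
by rewrite leq_pexp2l ?level_gt0.
Qed.

Lemma level_exp_ge N : (0 < N)%N -> (N <= (2 * level N) ^ q)%N.
Proof.
move=> N0; apply: leq_trans (ltnW (root_floor_exp_gt N q0)) _.
by rewrite leq_exp2r // mul2n -addnn -[X in (X <= _)%N]addn1 leq_add2l level_gt0.
Qed.

Lemma level_sqrt_le a N : (0 < N)%N -> (2 * a <= q)%N -> (level N)%:R ^+ a <= rt N.
Proof.
move=> N0 aq; rewrite -(@ler_pXn2r _ 2) ?nnegrE ?sqrtr_ge0 ?exprn_ge0 // sqr_sqrtr //.
by rewrite -exprM mulnC -natrX ler_nat level_exp_le.
Qed.

Lemma rt_gt0 N : (0 < N)%N -> 0 < rt N.
Proof. by move=> N0; rewrite sqrtr_gt0 ltr0n. Qed.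

Lemma rt_ge1 N : (0 < N)%N -> 1 <= rt N.
Proof. by move=> N0; rewrite -[leLHS]sqrtr1 ler_sqrt ?ltr01 // ler1n. Qed.

Lemma inv_sqr_le N (C : R) : 0 <= C -> (0 < N)%N ->
  C / N%:R ^+ 2 <= C * (N%:R * rt N)^-1.
Proof.
move=> C0 N0; apply: ler_wpM2l => //.
rewrite lef_pV2 ?posrE ?exprn_gt0 ?mulr_gt0 ?rt_gt0 ?ltr0n // expr2 ler_wpM2l //.
rewrite -(@ler_pXn2r _ 2) ?nnegrE ?sqrtr_ge0 // sqr_sqrtr // expr2 ler_peMr //.
by rewrite ler1n.
Qed.

Definition exceedances N w : R :=
  \sum_(i < N) \sum_(j < N) \1_[set x : R | (level N)%:R < `|x|] (X N i j w).

Lemma bounded_exceedance L N i j :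
  bounded_mfun (fun w => \1_[set x : R | L%:R < `|x|] (X N i j w) : R).
Proof.
apply: (@bounded_mfun_RV _ _ _ P (X N i j)); apply: bounded_mfun_indic.
exact: measurable_tail_set.
Qed.

Lemma bounded_exceedances N : bounded_mfun (exceedances N).
Proof. by apply: bounded_mfun_sum => i _; apply: bounded_mfun_sum => j _; exact: bounded_exceedance. Qed.

Lemma no_exceedance N w : ~ [set w | 1 <= exceedances N w] w ->
  forall i j, `|X N i j w| <= (level N)%:R.
Proof.
move=> /= /negP; rewrite -ltNge => lt i j; rewrite leNgt; apply/negP => Lx.
move: lt; rewrite ltNge => /negP; apply; rewrite /exceedances (bigD1 i) //= (bigD1 j) //=.
rewrite indicE mem_set //= -addrA lerDl addr_ge0 ?sumr_ge0 // => i' _.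
by apply: sumr_ge0.
Qed.

(** The moment of order [4 * q] beats the [N ^ 2] entries, as [N <= (2 * level N) ^ q]. *)
Lemma exceedances_rate : exists C : R, \forall N \near \oo,
  (P [set w | (1 <= exceedances N w)%R] <= (C * (N%:R * rt N)^-1)%:E)%E.
Proof.
pose M := moment rho (2 * (2 * q)).
have M0 : 0 <= M by apply: Rintegral_ge0 => x _; rewrite exprM exprn_ge0 ?sqr_ge0.
exists (M * 2 ^+ (4 * q)); exists 1%N => // N /= N0.
apply: (le_trans (expect_markov P (bounded_exceedances N) _ ltr01)) => [w|].
  by apply: sumr_ge0 => i _; apply: sumr_ge0 => j _.
rewrite lee_fin divr1; apply: le_trans (inv_sqr_le _ N0); last by rewrite mulr_ge0 ?exprn_ge0.
set L := level N; have L0 : (0 < L)%N by exact: level_gt0.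
have Lr : 0 < L%:R :> R by rewrite ltr0n.
have Nr : 0 < N%:R :> R by rewrite ltr0n.
have cst (x : R) : N%:R * x = \sum_(i < N) x by rewrite sumr_const card_ord mulr_natl.
have h1 : Ex (exceedances N) <= N%:R ^+ 2 * (M / L%:R ^+ (2 * (2 * q))).
  rewrite expect_sum => [|i _]; last by apply: bounded_mfun_sum => j _; exact: bounded_exceedance.
  rewrite expr2 -mulrA [leRHS]cst; apply: ler_sum => i _.
  rewrite expect_sum => [|j _]; last exact: bounded_exceedance.
  rewrite [leRHS]cst; apply: ler_sum => j _.
  have -> : Ex (fun w => \1_[set x : R | (level N)%:R < `|x|] (X N i j w)) =
       expect rho (\1_[set x : R | L%:R < `|x|] : R -> R).
    apply: expect_law; first exact: (wigner_law hX).
    by apply: bounded_mfun_indic; exact: measurable_tail_set.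
  rewrite -lee_fin expect_indic; last exact: measurable_tail_set.
  exact: (tail_le (wigner_moments hX)).
apply: (le_trans h1); rewrite mulnA (_ : 2 * 2 = 4)%N //.
have key : N%:R ^+ 4 <= 2 ^+ (4 * q) * L%:R ^+ (4 * q) :> R.
  rewrite -exprMn mulnC exprM lerXn2r ?nnegrE ?exprn_ge0 ?mulr_ge0 ?ler0n //.
  by rewrite -natrM -natrX ler_nat level_exp_ge.
rewrite ler_pdivlMr ?exprn_gt0 //.
rewrite (_ : _ * _ * _ = M * (N%:R ^+ 4 / L%:R ^+ (4 * q))); last by ring.
by apply: ler_wpM2l => //; rewrite ler_pdivrMr ?exprn_gt0.
Qed.

Hypothesis v_def : v = moment rho 2 - moment rho 1 ^+ 2.

Lemma sigma_cvg : sigma rho \o level @ \oo --> Num.sqrt v.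
Proof.
have h := cvg_sigma_sqr (wigner_moments hX) v_def.
have e : sigma rho = fun L => Num.sqrt (sigma rho L ^+ 2).
  by apply/funext => L; rewrite sqrtr_sqr ger0_norm // sigma_ge0.
have h2 : sigma rho @ \oo --> Num.sqrt v.
  rewrite e; apply: (@continuous_cvg _ _ _ _ _ _ (@Num.sqrt R)); last exact: h.
  exact: sqrt_continuous.
exact: cvg_comp level_cvg h2.
Qed.

Lemma inv_level_cvg : (fun N => (level N)%:R^-1 : R) @ \oo --> (0 : R).
Proof.
apply/cvgrPdist_le => e e0; near=> N.
have L0 : (0 < level N)%N by apply: level_gt0; near: N; exists 1%N.
rewrite sub0r normrN ger0_norm ?invr_ge0 // -[leRHS]invrK lef_pV2 ?posrE ?invr_gt0 ?ltr0n //.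
near: N; exact: (level_cvg (nbhs_infty_ger e^-1)).
Unshelve. all: by end_near. Qed.

Lemma walk_rate_level_le l N c : (0 < N)%N -> 0 <= c -> exceptional_cost (2 * (level N)%:R) l <= c * (level N)%:R ^+ 4 ->
  walk_rate (sigma rho (level N)) (2 * (level N)%:R) (rt N) l <=
    (2 * sigma rho (level N) + c / (level N)%:R) * rt N.
Proof.
move=> N0 c0 h; have L0 : 0 < (level N)%:R :> R by rewrite ltr0n level_gt0.
rewrite /walk_rate [leRHS]mulrDl; apply: lerD; first by rewrite mulrA.
apply: (le_trans h); rewrite mulrAC ler_pdivlMr // -mulrA -exprSr.
by apply: ler_wpM2l => //; apply: level_sqrt_le.
Qed.

(** Markov's inequality for the power [2 * level N]: the walk rate is smaller than
    [b * sqrt N] by a factor [1 + h], and the power of [1 + h] beats [N]. *)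
Lemma trace_upper_rate b : 2 * Num.sqrt v < b -> exists C : R, \forall N \near \oo,
  (P [set w | ((b * rt N) ^+ (2 * level N) <= \tr (W N w ^+ (2 * level N)))%R]
    <= (C * (N%:R * rt N)^-1)%:E)%E.
Proof.
move=> vb; have sv0 : 0 <= Num.sqrt v by exact: sqrtr_ge0.
have b0 : 0 < b by apply: le_lt_trans vb; rewrite mulr_ge0.
pose h := (b - 2 * Num.sqrt v) / (2 * (2 * Num.sqrt v + 1)).
have h0 : 0 < h by rewrite divr_gt0 ?subr_gt0 // mulr_gt0 // ltr_wpDl // mulr_ge0.
have hb : (2 * Num.sqrt v) * (1 + h) < b.
  have e : h * (2 * (2 * Num.sqrt v + 1)) = b - 2 * Num.sqrt v.
    by rewrite divfK // gt_eqF // mulr_gt0 // ltr_wpDl // mulr_ge0.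
  nra.
have rate_near : \forall N \near \oo,
   (2 * sigma rho (level N) + 40 / (level N)%:R) * (1 + h) < b.
  have c : (fun N => (2 * sigma rho (level N) + 40 * (level N)%:R^-1) * (1 + h)) @ \oo
     --> (2 * Num.sqrt v + 40 * 0) * (1 + h).
    apply: cvgM; last exact: cvg_cst.
    by apply: cvgD; apply: cvgM; [exact: cvg_cst|exact: sigma_cvg|exact: cvg_cst|exact: inv_level_cvg].
  by apply: (cvgr_lt _ c); rewrite mulr0 addr0.
(* N ^ 3 is at most (level N + 1) ^ (3 * q) *)
have [C hC] := poly_geometric_bounded (3 * q) h0.
have h1 : 0 < 1 + h by rewrite addr_gt0.
have C0 : 0 <= C.
  by have := hC 0%N; rewrite expr0 mulr1; apply: le_trans; rewrite exprn_ge0.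
exists (C * (1 + h)); near=> N.
have N0 : (0 < N)%N by near: N; exists 1%N.
have Nr : 0 < N%:R :> R by rewrite ltr0n.
have rN : (2 * sigma rho (level N) + 40 / (level N)%:R) * (1 + h) < b by near: N.
set L := level N in rN *; have L0 : (0 < L)%N by exact: level_gt0.
have a0 : 0 < (b * rt N) ^+ (2 * L) by rewrite exprn_gt0 // mulr_gt0 // rt_gt0.
have bt : bounded_mfun (fun w => \tr (W N w ^+ (2 * L))) by exact: bounded_trace.
apply: (le_trans (expect_markov P bt _ a0)).
  move=> w; have [U [e hU]] := symmetric_eigenbasis (truncated_sample_sym hX L N w).
  by rewrite (eigenbasis_mxtraceX _ hU); apply: sumr_ge0 => i _; rewrite exprM exprn_ge0 ?sqr_ge0.
rewrite lee_fin; apply: le_trans (inv_sqr_le _ N0); last by rewrite mulr_ge0 // ltW.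
have l0 : (0 < 2 * L)%N by rewrite muln_gt0.
set rate := walk_rate (sigma rho L) (2 * L%:R) (rt N) (2 * L).
have rate0 : 0 <= rate.
  by rewrite walk_rate_ge0 ?sigma_ge0 ?sigma_le // rt_ge1.
have er : rate * (1 + h) <= b * rt N.
  have : rate <= (2 * sigma rho L + 40 / L%:R) * rt N.
    apply: walk_rate_level_le => //; rewrite /exceptional_cost.
    have L1 : 1 <= L%:R :> R by rewrite ler1n.
    have -> : (2 * (2 * L)).+1%:R * ((2 * L)%:R ^+ 2 * (2 * L%:R)) =
       8 * (4 * L%:R + 1) * L%:R ^+ 3 :> R by rewrite -natr1 !natrM; ring.
    rewrite (exprS _ 3) mulrA; apply: ler_wpM2r; first by rewrite exprn_ge0.
    lra.
  move=> hr; apply: (le_trans (ler_wpM2r (ltW h1) hr)).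
  rewrite mulrAC; apply: ler_wpM2r; first exact: sqrtr_ge0.
  exact: ltW.
have step1 : Ex (fun w => \tr (W N w ^+ (2 * L))) <= N%:R * rate ^+ (2 * L).
  exact: (expect_trace_le hX).
apply: (@le_trans _ _ (N%:R / (1 + h) ^+ (2 * L))).
  rewrite ler_pdivrMr // mulrAC ler_pdivlMr ?exprn_gt0 //.
  apply: (le_trans (ler_wpM2r _ step1)); first by rewrite exprn_ge0 // ltW.
  rewrite -mulrA ler_wpM2l // -exprMn lerXn2r ?nnegrE ?mulr_ge0 // ?(ltW h1) ?(ltW b0) ?sqrtr_ge0 //.
rewrite ler_pdivrMr ?exprn_gt0 // mulrAC ler_pdivlMr ?exprn_gt0 // -exprS.
apply: (@le_trans _ _ (L.+1%:R ^+ (3 * q))).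
  rewrite mulnC exprM lerXn2r ?nnegrE ?exprn_ge0 // -natrX ler_nat.
  by apply: ltnW; exact: root_floor_exp_gt.
apply: (le_trans (hC _)); rewrite exprS -!mulrA ler_wpM2l // ler_wpM2l ?(ltW h1) //.
by apply: ler_weXn2l; [rewrite lerDl ltW|rewrite leq_pmull].
Unshelve. all: by end_near. Qed.

Variable k : nat.
Hypotheses (k0 : (0 < k)%N) (kq : (8 * k <= q)%N).

Definition mean_trace N := Ex (fun w => \tr (W N w ^+ (2 * k))).
Let cat : R := (ballot (2 * k) 0)%:R.

Lemma rt_exp N : rt N ^+ (2 * k) = N%:R ^+ k.
Proof. by rewrite exprM sqr_sqrtr. Qed.

(** The Catalan moments of the semicircle law. *)
Lemma mean_trace_cvg :
  (fun N => mean_trace N / N%:R ^+ k.+1) @ \oo --> Num.sqrt v ^+ (2 * k) * cat.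
Proof.
set p := (2 * k)%N; have p0 : (0 < p)%N by rewrite muln_gt0.
pose c0 : R := (2 * p).+1%:R * (p%:R ^+ 2 * 2).
have c00 : 0 <= c0 by rewrite !mulr_ge0 ?exprn_ge0.
pose D N : R := (2 * c0 * p%:R) * (level N)%:R^-1 *
   (2 * sigma rho (level N) + c0 * (level N)%:R^-1) ^+ p.-1.
have cX (u : nat -> R) (l : R) n : u @ \oo --> l -> (fun N => u N ^+ n) @ \oo --> l ^+ n.
  move=> ul; elim: n => [|n IH]; first by rewrite expr0; exact: cvg_cst.
  by under eq_fun do rewrite exprS; rewrite exprS; exact: cvgM.
have cD : D @ \oo --> (0 : R).
  rewrite [X in _ --> X](_ : 0 = (2 * c0 * p%:R) * 0 * (2 * Num.sqrt v + c0 * 0) ^+ p.-1); last by ring.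
  apply: cvgM; first by apply: cvgM; [exact: cvg_cst|exact: inv_level_cvg].
  apply: (cX (fun N => 2 * sigma rho (level N) + c0 * (level N)%:R^-1)); apply: cvgD.
    by apply: cvgM; [exact: cvg_cst|exact: sigma_cvg].
  by apply: cvgM; [exact: cvg_cst|exact: inv_level_cvg].
have cS : (fun N => sigma rho (level N) ^+ p * cat) @ \oo --> Num.sqrt v ^+ p * cat.
  by apply: cvgM; [apply: (cX (fun N => sigma rho (level N))); exact: sigma_cvg|exact: cvg_cst].
suff cE : (fun N => mean_trace N / N%:R ^+ k.+1 - sigma rho (level N) ^+ p * cat) @ \oo --> (0 : R).
  rewrite (_ : (fun N => _) = (fun N => (mean_trace N / N%:R ^+ k.+1
    - sigma rho (level N) ^+ p * cat) + sigma rho (level N) ^+ p * cat)).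
    by rewrite -[X in _ --> X]add0r; exact: (cvgD cE cS).
  by apply/funext => N; rewrite subrK.
apply/cvgrPdist_le => e e0; near=> N.
have N0 : (0 < N)%N by near: N; exists 1%N.
have De : `|0 - D N| <= e by near: N; move/cvgrPdist_le : cD => /(_ e e0).
apply: le_trans De; rewrite !sub0r !normrN.
have Nr : 0 < N%:R :> R by rewrite ltr0n.
have L0 := level_gt0 N0; have Lr : 0 < (level N)%:R :> R by rewrite ltr0n.
have L1 : 1 <= (level N)%:R :> R by rewrite ler1n.
have s0 : 0 <= 2 * sigma rho (level N) + c0 * (level N)%:R^-1.
  by rewrite addr_ge0 ?mulr_ge0 ?invr_ge0 ?sigma_ge0.
have D0 : 0 <= D N by rewrite !mulr_ge0 ?exprn_ge0 ?invr_ge0.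
rewrite (ger0_norm D0).
have r0 := rt_gt0 N0.
have Nk : N%:R ^+ k.+1 = N%:R * rt N ^+ p :> R by rewrite rt_exp exprS.
have Nk0 : 0 < N%:R * rt N ^+ p :> R by rewrite mulr_gt0 ?exprn_gt0.
have -> : mean_trace N / N%:R ^+ k.+1 - sigma rho (level N) ^+ p * cat =
   (mean_trace N - N%:R * (sigma rho (level N) ^+ p * rt N ^+ p * cat)) / (N%:R * rt N ^+ p).
  by rewrite Nk; field; rewrite !gt_eqF // exprn_gt0.
rewrite normrM [X in _ * X]ger0_norm ?invr_ge0 ?(ltW Nk0) // ler_pdivrMr //.
apply: (le_trans (expect_trace_approx hX (level N) N0 p0 (leqnn p))).
set rate := walk_rate _ _ _ _.
have rate0 : 0 <= rate by rewrite walk_rate_ge0 ?sigma_ge0 ?sigma_le // rt_ge1.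
have ec : exceptional_cost (2 * (level N)%:R) p = c0 * (level N)%:R :> R by rewrite /exceptional_cost /c0; ring.
have hr : rate <= (2 * sigma rho (level N) + c0 / (level N)%:R) * rt N.
  apply: walk_rate_level_le => //; rewrite ec; apply: ler_wpM2l => //.
  by rewrite exprS ler_peMr ?(ltW Lr) // exprn_ege1.
rewrite ec [leRHS]mulrCA; apply: ler_wpM2l; first exact: ltW.
apply: (@le_trans _ _ (2 * (c0 * (level N)%:R) * p%:R *
   ((2 * sigma rho (level N) + c0 / (level N)%:R) * rt N) ^+ p.-1)).
  apply: ler_wpM2l; first by rewrite !mulr_ge0 ?(ltW Lr).
  by rewrite lerXn2r ?nnegrE // mulr_ge0 // ltW.
rewrite /D exprMn; set Y := _ ^+ p.-1; have Y0 : 0 <= Y by rewrite exprn_ge0.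
have -> : rt N ^+ p = rt N * rt N ^+ p.-1 by rewrite -exprS prednK.
have -> : 2 * (c0 * (level N)%:R) * p%:R * (Y * rt N ^+ p.-1) =
   (2 * c0 * p%:R * Y * rt N ^+ p.-1) * (level N)%:R by ring.
have -> : 2 * c0 * p%:R / (level N)%:R * Y * (rt N * rt N ^+ p.-1) =
   (2 * c0 * p%:R * Y * rt N ^+ p.-1) * (rt N / (level N)%:R) by ring.
apply: ler_wpM2l; first by rewrite !mulr_ge0 // exprn_ge0 // ltW.
rewrite ler_pdivlMr // -expr2; apply: level_sqrt_le => //.
by apply: leq_trans q10.
Unshelve. all: by end_near. Qed.

Definition trace_deviation (delta : R) N :=
  [set w | (delta * N%:R ^+ k.+1) ^+ 2 <= (\tr (W N w ^+ (2 * k)) - mean_trace N) ^+ 2].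

(** Chebyshev's inequality; [8 * k <= q] bounds the factor [level N ^ (4 * k)] of the
    variance by [sqrt N]. *)
Lemma trace_deviation_rate delta : 0 < delta -> exists C : R, \forall N \near \oo,
  (P (trace_deviation delta N) <= (C * (N%:R * rt N)^-1)%:E)%E.
Proof.
move=> d0; set p := (2 * k)%N; have p0 : (0 < p)%N by rewrite muln_gt0.
pose c1 : R := p%:R ^+ p * p%:R ^+ p * (2 * 2 ^+ (p + p)).
have c10 : 0 <= c1 by rewrite !mulr_ge0 ?exprn_ge0.
exists (c1 / delta ^+ 2); exists 1%N => // N /= N0.
have Nr : 0 < N%:R :> R by rewrite ltr0n.
have r0 := rt_gt0 N0.
have a0 : 0 < (delta * N%:R ^+ k.+1) ^+ 2 by rewrite exprn_gt0 // mulr_gt0 // exprn_gt0.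
have bv : bounded_mfun (fun w => (\tr (W N w ^+ p) - mean_trace N) ^+ 2).
  by apply: bounded_mfunX; apply: bounded_mfunB; [exact: bounded_trace|exact: bounded_mfun_cst].
apply: (le_trans (expect_markov P bv (fun w => sqr_ge0 _) a0)).
rewrite lee_fin ler_pdivrMr //; apply: (le_trans (trace_variance_le hX (level N) N p0)).
have -> : N%:R ^+ p * (p%:R ^+ p * p%:R ^+ p) * (2 * (2 * (level N)%:R) ^+ (p + p)) =
   c1 * (N%:R ^+ p * (level N)%:R ^+ (p + p)) :> R by rewrite /c1 exprMn; ring.
have -> : c1 / delta ^+ 2 * (N%:R * rt N)^-1 * (delta * N%:R ^+ k.+1) ^+ 2 =
    c1 * ((N%:R * rt N)^-1 * (N%:R ^+ k.+1) ^+ 2).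
  by rewrite exprMn; field; rewrite !gt_eqF // exprn_gt0.
apply: ler_wpM2l => //.
have -> : (N%:R ^+ k.+1) ^+ 2 = N%:R ^+ p * (N%:R * (rt N * rt N)) :> R.
  by rewrite -[rt N * rt N]expr2 sqr_sqrtr // -exprM mulnC mulnS exprD -/p mulrC expr2.
rewrite (_ : _^-1 * _ = N%:R ^+ p * rt N); last by field; rewrite !gt_eqF.
apply: ler_wpM2l; first exact: exprn_ge0.
apply: level_sqrt_le => //; apply: leq_trans kq; rewrite /p; lia.
Qed.

Lemma trace_lower a : a < Num.sqrt v ^+ (2 * k) * cat ->
  exists2 delta : R, 0 < delta & \forall N \near \oo, forall w,
    ~ trace_deviation delta N w -> a * N%:R ^+ k.+1 < \tr (W N w ^+ (2 * k)).
Proof.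
move=> ac; pose delta := (Num.sqrt v ^+ (2 * k) * cat - a) / 2.
have d0 : 0 < delta by rewrite divr_gt0 ?subr_gt0.
exists delta => //; near=> N => w.
have N0 : (0 < N)%N by near: N; exists 1%N.
have Nk : 0 < N%:R ^+ k.+1 :> R by rewrite exprn_gt0 // ltr0n.
have hE : a + delta < mean_trace N / N%:R ^+ k.+1.
  near: N; apply: (cvgr_gt _ mean_trace_cvg); rewrite /delta; lra.
rewrite ltr_pdivlMr // in hE.
rewrite /trace_deviation /= => /negP; rewrite -ltNge => dev.
have : `|\tr (W N w ^+ (2 * k)) - mean_trace N| < delta * N%:R ^+ k.+1.
  have dN : 0 <= delta * N%:R ^+ k.+1 := mulr_ge0 (ltW d0) (ltW Nk).
  rewrite -(@ltr_pXn2r _ 2) ?nnegrE //.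
  by rewrite real_normK ?num_real.
rewrite ltr_norml => /andP[h _]; lra.
Unshelve. all: by end_near. Qed.
End Asymptotics.

(** The Catalan moments grow at the exponential rate [4 ^ k]; the polynomial factor
    of [ballot_growth] is absorbed by a large [k]. *)
Lemma ballot_exponent (R : realType) (s t : R) : 0 <= t -> t < 2 * s ->
  exists2 k, (0 < k)%N & t ^+ (2 * k) < s ^+ (2 * k) * (ballot (2 * k) 0)%:R.
Proof.
move=> t0 ts; have s0 : 0 < s by lra.
pose u := Num.max t s; have tu : t <= u by rewrite le_max lexx.
have u0 : 0 < u by rewrite lt_max s0 orbT.
have us : u < 2 * s by rewrite gt_max ts /=; lra.
pose h := 2 * s / u - 1; have h0 : 0 < h by rewrite subr_gt0 ltr_pdivlMr // mul1r.
(* exponent 3, so that C * (1 + h) ^+ (2 * k) still exceeds C times a quadratic in k > C *)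
have [C hC] := poly_geometric_bounded 3 h0.
have h1 : 0 < 1 + h by rewrite addr_gt0.
have C0 : 0 < C.
  have := hC 1%N; rewrite !expr1 expr1n => hh.
  by rewrite -(pmulr_lgt0 _ h1) (lt_le_trans ltr01).
have [k k0 kC] : exists2 k, (0 < k)%N & C < k%:R.
  by exists (Num.truncn C).+1 => //; exact: truncnS_gt.
exists k => //.
have k1 : 1 <= k%:R :> R by rewrite ler1n.
have big : (2 * k).+1%:R * k.+1%:R < (1 + h) ^+ (2 * k).
  have := hC (2 * k)%N; rewrite natrM => hh.
  rewrite -(ltr_pM2l C0); apply: lt_le_trans hh.
  apply: (@lt_le_trans _ _ (k%:R * ((2 * k).+1%:R * k.+1%:R))).
    by rewrite ltr_pM2r // mulr_gt0 ?ltr0n.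
  rewrite exprMn (exprS k%:R) mulrCA; apply: ler_wpM2l; first by rewrite ler0n.
  have -> : 2 ^+ 3 = 8 :> R by ring.
  rewrite -[(2 * k).+1%:R]natr1 -[k.+1%:R]natr1 natrM expr2.
  move: (k%:R : R) k1 => x x1; nra.
have hu : (1 + h) * u = 2 * s by rewrite /h addrC subrK divfK // gt_eqF.
apply: (@le_lt_trans _ _ (u ^+ (2 * k))); first by rewrite lerXn2r ?nnegrE ?(ltW u0).
have cat := ballot_growth k.
have cat' : 4 ^+ k <= (2 * k).+1%:R * k.+1%:R * (ballot (2 * k) 0)%:R :> R.
  by rewrite -natrX -!natrM ler_nat.
have B0 : 0 < (2 * k).+1%:R * k.+1%:R :> R by rewrite mulr_gt0 ?ltr0n.
rewrite -(ltr_pM2l B0) mulrCA.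
apply: (@lt_le_trans _ _ (s ^+ (2 * k) * 4 ^+ k)); last first.
  by rewrite ler_wpM2l // exprn_ge0 // ltW.
have -> : s ^+ (2 * k) * 4 ^+ k = (2 * s) ^+ (2 * k).
  by rewrite exprMn mulrC (exprM 2) -[2 ^+ 2]natrX.
by rewrite -hu exprMn ltr_pM2r // exprn_gt0.
Qed.

(** * Measurability of the second largest singular value *)

Section MeasurableSingularValues.
Context d (T : measurableType d) (R : realType).
Variables (N : nat) (A : T -> 'M[R]_N).
Hypotheses (mA : forall i j, measurable_fun setT (fun w => A w i j))
  (sA : forall w, (A w)^T = A w) (N2 : (2 <= N)%N).

Lemma measurable_trace_exprmx n : measurable_fun setT (fun w => \tr (A w ^+ n)).
Proof.
suff H i j : measurable_fun setT (fun w => (A w ^+ n) i j) by apply: measurable_sum.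
elim: n i j => [|n IH] i j.
  by under eq_fun do rewrite expr0 mxE; exact: measurable_cst.
under eq_fun do rewrite exprmxS_entry; apply: measurable_sum => k.
exact: measurable_funM.
Qed.

Lemma measurable_fun_ge0_le_sets (f : T -> R) : (forall w, 0 <= f w) ->
  (forall t, 0 <= t -> measurable [set w | f w <= t]) -> measurable_fun setT f.
Proof.
move=> f0 h; apply: measurable_fun_le_sets => t; have [t0|t0] := leP 0 t; first exact: h.
rewrite (_ : [set w | _] = set0) //; apply/seteqP; split => w //= ft.
by have := le_trans (f0 w) ft; rewrite leNgt t0.
Qed.

Lemma measurable_largest_singular_value :
  measurable_fun setT (fun w => largest_singular_value (A w)).
Proof.
apply: measurable_fun_ge0_le_sets => [w|t t0].
  by have [s [_ _ _ h1 h2]] := singular_values_split (sA w) N2; exact: le_trans h2.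
rewrite (_ : [set w | _] =
    \bigcap_k [set w | \tr (A w ^+ (2 * k)) <= N%:R * t ^+ (2 * k)]).
  apply: bigcap_measurable => [|k _]; first by exists 0%N.
  by apply: measurable_le_set; [exact: measurable_trace_exprmx|exact: measurable_cst].
apply/seteqP; split => w /=.
  by move=> /(largest_singular_value_le (sA w) N2 t0) h k _; exact: h.
by move=> h; apply/(largest_singular_value_le (sA w) N2 t0) => k; exact: h.
Qed.

Lemma measurable_singular_value_product :
  measurable_fun setT (fun w => largest_singular_value (A w) * second_singular_value (A w)).
Proof.
apply: measurable_fun_ge0_le_sets => [w|t t0].
  have [s [_ _ _ h1 h2]] := singular_values_split (sA w) N2.
  by rewrite mulr_ge0 // (le_trans h1).
rewrite (_ : [set w | _] = \bigcap_k [set w | \tr (A w ^+ (2 * k)) ^+ 2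
    - \tr (A w ^+ (2 * (2 * k))) <= N%:R ^+ 2 * t ^+ (2 * k)]).
  apply: bigcap_measurable => [|k _]; first by exists 0%N.
  apply: measurable_le_set; last exact: measurable_cst.
  apply: measurable_funB; last exact: measurable_trace_exprmx.
  by apply: measurable_funX; exact: measurable_trace_exprmx.
apply/seteqP; split => w /=.
  by move=> /(singular_value_product_le (sA w) N2 t0) h k _; exact: h.
by move=> h; apply/(singular_value_product_le (sA w) N2 t0) => k; exact: h.
Qed.

(** Cross-multiplication by the largest singular value is an equivalence even if
    that value is [0], since then both are [0]. *)
Lemma measurable_second_singular_value :
  measurable_fun setT (fun w => second_singular_value (A w)).
Proof.
apply: measurable_fun_ge0_le_sets => [w|t t0].
  by have [s []] := singular_values_split (sA w) N2.
rewrite (_ : [set w | _] = [set w | largest_singular_value (A w) * second_singular_value (A w)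
    <= largest_singular_value (A w) * t]).
  apply: measurable_le_set; first exact: measurable_singular_value_product.
  apply: measurable_funM; [exact: measurable_largest_singular_value|exact: measurable_cst].
apply/seteqP; split => w /=; have [s [_ _ _ h1 h2]] := singular_values_split (sA w) N2.
  by move=> h; apply: ler_wpM2l => //; exact: le_trans h2.
have [l0|l0] := ltP 0 (largest_singular_value (A w)); first by rewrite ler_pM2l.
by move=> _; apply: le_trans t0; exact: le_trans l0.
Qed.
End MeasurableSingularValues.

(** * Almost sure bounds *)

Section AlmostSureBounds.
Context d (T : measurableType d) (R : realType) (P : probability T R)
  (X : forall N : nat, 'M[{RV P >-> R}]_N) (rho : probability R R) (m v : R).
Hypothesis hX : wigner_ensemble m v X rho.
Local Notation rt N := (Num.sqrt (N%:R : R)).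
Local Notation ssv N w := (second_singular_value (sample (X N) w)).

Lemma variance_moments : v = moment rho 2 - moment rho 1 ^+ 2.
Proof.
have e1 : moment rho 1 = m.
  rewrite /moment /Rintegral (_ : (fun x : R => _) = (fun x : R => x%:E)) ?(wigner_mean hX) //.
have := wigner_variance hX; rewrite -(fineK (integrable_fin_num measurableT (wigner_moments hX 2))).
by rewrite e1 => -[<-].
Qed.

Section Level.
Variable q : nat.
Hypothesis q10 : (10 <= q)%N.
Local Notation W N w := (truncated_sample X rho (root_floor q N) N w).

Lemma measurable_trace_truncated N n : measurable_fun setT (fun w => \tr (W N w ^+ n)).
Proof.
by have [] : bounded_mfun (fun w => \tr (W N w ^+ n)) by exact: bounded_trace.
Qed.

Lemma truncation_ae : {ae P, forall w, \forall N \near \oo,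
  (\rank (sample (X N) w - W N w)%R <= 1)%N}.
Proof.
have [C hC] := exceedances_rate hX q10.
apply: filterS (borel_cantelli_rate _ hC) => [w|N]; last first.
  by apply: measurable_le_set; [exact: measurable_cst|case: (bounded_exceedances X q N)].
by apply: filterS => N h; apply: sample_sub_truncated; exact: no_exceedance h.
Qed.

Lemma trace_upper_ae b : 2 * Num.sqrt v < b -> {ae P, forall w, \forall N \near \oo,
  \tr (W N w ^+ (2 * root_floor q N)) < (b * rt N) ^+ (2 * root_floor q N)}.
Proof.
move=> vb; have [C hC] := trace_upper_rate hX q10 variance_moments vb.
apply: filterS (borel_cantelli_rate _ hC) => [w|N]; last first.
  by apply: measurable_le_set; [exact: measurable_cst|exact: measurable_trace_truncated].
by apply: filterS => N /= /negP; rewrite -ltNge.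
Qed.

Lemma trace_lower_ae k a : (0 < k)%N -> (8 * k <= q)%N ->
  a < Num.sqrt v ^+ (2 * k) * (ballot (2 * k) 0)%:R -> {ae P, forall w, \forall N \near \oo,
  a * N%:R ^+ k.+1 < \tr (W N w ^+ (2 * k))}.
Proof.
move=> k0 kq ak; have [delta d0 hd] := trace_lower hX q10 variance_moments k0 ak.
have [C hC] := trace_deviation_rate hX q10 k0 kq d0.
apply: filterS (borel_cantelli_rate _ hC) => [w|N]; last first.
  apply: measurable_le_set; first exact: measurable_cst.
  apply: measurable_funX; apply: measurable_funB; last exact: measurable_cst.
  exact: measurable_trace_truncated.
by apply: filterS2 hd => N h; apply: h.
Qed.
End Level.

Lemma second_singular_value_upper_ae b : 2 * Num.sqrt v < b ->
  {ae P, forall w, \forall N \near \oo, ssv N w < b * rt N}.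
Proof.
move=> vb; have b0 : 0 <= b by apply: ltW; apply: le_lt_trans vb; rewrite mulr_ge0 // sqrtr_ge0.
apply: filterS2 (truncation_ae (leqnn 10)) (trace_upper_ae (leqnn 10) vb) => w h1 h2.
near=> N; apply: (@second_singular_value_lt _ _ _ (truncated_sample X rho (root_floor 10 N) N w) (root_floor 10 N)).
- exact: (wigner_symmetric hX).
- exact: truncated_sample_sym hX _ _ _.
- by near: N; exists 2%N.
- by near: N.
- by rewrite mulr_ge0 // sqrtr_ge0.
- by near: N.
Unshelve. all: by end_near. Qed.

Lemma second_singular_value_lower_ae t : t < 2 * Num.sqrt v ->
  {ae P, forall w, \forall N \near \oo, t * rt N <= ssv N w}.
Proof.
move=> tv; have [t0|t0] := ltP t 0.
  apply: aeW => w; near=> N; have N2 : (2 <= N)%N by near: N; exists 2%N.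
  have [s [_ _ _ h _]] := singular_values_split (wigner_symmetric hX N w) N2.
  by apply: le_trans h; rewrite nmulr_rle0 // sqrtr_ge0.
have [k k0 hk] := ballot_exponent t0 tv.
pose c := Num.sqrt v ^+ (2 * k) * (ballot (2 * k) 0)%:R.
pose a := (t ^+ (2 * k) + c) / 2.
have ac : a < c by rewrite /a; rewrite -/c in hk; lra.
have at0 : 0 < a - t ^+ (2 * k) by rewrite /a; rewrite -/c in hk; lra.
pose b := 2 * Num.sqrt v + 1; have vb : 2 * Num.sqrt v < b by rewrite ltrDl.
have b0 : 0 <= b by rewrite addr_ge0 ?mulr_ge0 ?sqrtr_ge0.
(* the exponent of the truncation level depends on the moment used *)
pose q := (10 + 8 * k)%N; have q10 : (10 <= q)%N by rewrite leq_addr.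
have kq : (8 * k <= q)%N by rewrite leq_addl.
apply: filterS3 (truncation_ae q10) (trace_upper_ae q10 vb) (trace_lower_ae q10 k0 kq ac) => w h1 h2 h3.
near=> N; have N1 : (2 <= N)%N by near: N; exists 2%N.
have N0 : 0 < N%:R :> R by rewrite ltr0n; apply: leq_trans N1.
apply: (@second_singular_value_lower _ _ _ (truncated_sample X rho (root_floor q N) N w)
   k (root_floor q N) _ (b * rt N)) => //.
- exact: (wigner_symmetric hX).
- exact: truncated_sample_sym hX _ _ _.
- by near: N.
- by rewrite mulr_ge0 // sqrtr_ge0.
- by rewrite mulr_ge0 // sqrtr_ge0.
- by near: N.
have h3N : a * N%:R ^+ k.+1 < \tr (truncated_sample X rho (root_floor q N) N w ^+ (2 * k)).
  by near: N.
apply: lt_trans h3N; rewrite !exprMn rt_exp.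
have -> : N%:R * (t ^+ (2 * k) * N%:R ^+ k) + 2 * (b ^+ (2 * k) * N%:R ^+ k) =
   (N%:R * t ^+ (2 * k) + 2 * b ^+ (2 * k)) * N%:R ^+ k by ring.
have hN : 2 * b ^+ (2 * k) / (a - t ^+ (2 * k)) < N%:R.
  by near: N; exact: nbhs_infty_gtr.
rewrite ltr_pdivrMr // in hN; rewrite exprS mulrA ltr_pM2r ?exprn_gt0 //; lra.
Unshelve. all: by end_near. Qed.
End AlmostSureBounds.

Theorem proposition6 (d : measure_display) (T : measurableType d)
    (R : realType) (P : probability T R)
    (X : forall N : nat, 'M[{RV P >-> R}]_N)
    (rho : probability R R) (m v : R)
    (hX : wigner_ensemble m v X rho) :
  let E := [set w : T |
    second_singular_value (sample (X N) w) / Num.sqrt (N%:R : R)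
      @[N --> \oo] --> 2 * Num.sqrt v] in
  measurable E /\ P E = 1%E.
Proof.
move=> E.
have mE : measurable E.
  (* the index is shifted because the singular value is meaningful from size 2 on *)
  pose f n w := second_singular_value (sample (X n.+2) w) / Num.sqrt (n.+2%:R : R).
  rewrite (_ : E = [set w | f n w @[n --> \oo] --> 2 * Num.sqrt v]).
    apply: measurable_cvg_set => n; apply: measurable_funM; last exact: measurable_cst.
    apply: measurable_second_singular_value => // [i j|w]; last exact: (wigner_symmetric hX).
    by under eq_fun do rewrite mxE; exact: measurable_funPT.
  apply/funext => w; rewrite /E /=; set g := fun N : nat => _ / _.
  have -> : (fun n => f n w) = (fun n => g (n + 2)%N) by apply/funext => n; rewrite addn2.
  exact/esym/(cvg_shiftn 2).
split => //.
have H : {ae P, forall w, E w}.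
  pose U j w := \forall N \near \oo, second_singular_value (sample (X N) w)
    < (2 * Num.sqrt v + j.+1%:R^-1) * Num.sqrt (N%:R : R).
  pose L j w := \forall N \near \oo, (2 * Num.sqrt v - j.+1%:R^-1) * Num.sqrt (N%:R : R)
    <= second_singular_value (sample (X N) w).
  have hj (j : nat) : P.-negligible (~` [set w | U j w /\ L j w]).
    have hu : {ae P, forall w, U j w}.
      by apply: (second_singular_value_upper_ae hX); rewrite ltrDl invr_gt0 ltr0n.
    have hl : {ae P, forall w, L j w}.
      by apply: (second_singular_value_lower_ae hX); rewrite gtrBl invr_gt0 ltr0n.
    exact: filterI hu hl.
  have := negligible_bigcup hj; apply: negligibleS => w /= nE.
  apply: contrapT => nU; apply: nE; apply/cvgrPdist_le => e e0.
  have [j je] := exists_inv_natS_le e0.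
  have [h1 h2] : U j w /\ L j w by apply: contrapT => h; apply: nU; exists j.
  near=> N; have N0 : 0 < Num.sqrt (N%:R : R).
    by rewrite sqrtr_gt0 ltr0n; near: N; exists 1%N.
  have a1 : second_singular_value (sample (X N) w)
       < (2 * Num.sqrt v + j.+1%:R^-1) * Num.sqrt (N%:R : R) by near: N.
  have a2 : (2 * Num.sqrt v - j.+1%:R^-1) * Num.sqrt (N%:R : R)
       <= second_singular_value (sample (X N) w) by near: N.
  apply: le_trans je; rewrite ler_norml.
  rewrite -ltr_pdivrMr // in a1; rewrite -ler_pdivlMr // in a2.
  move: a1 a2; move: (_ / Num.sqrt N%:R) (Num.sqrt v) (j.+1%:R^-1) => y s z a1 a2.
  by apply/andP; split; lra.
have nE : P (~` E) = 0%E by apply: measure_negligible; [exact: measurableC|exact: H].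
rewrite -[E]setCK probability_setC; last exact: measurableC.
by rewrite nE sube0.
Unshelve. all: by end_near. Qed.
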